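(* Let $\alpha\in(0,1)$, $T>0$, let $\Omega\subset\mathbb{R}^d$ ($d\in\{1,2,3\}$) be a bounded Lipschitz domain, and let $\mathcal{L}$ be a linear second-order elliptic operator in the spatial variable such that, for some $\lambda\ge0$, $\langle \mathcal{L}v,v\rangle\ge\lambda\|v\|^2$ for all $v\in H^1_0(\Omega)$. Consider the problem $$D_t^\alpha u+\mathcal{L}u=f(x,t)\ \text{ for }(x,t)\in\Omega\times(0,T],\qquad u(\cdot,0)=u_0\ \text{ in }\Omega,\qquad u=0\ \text{ on }\partial\Omega\text{ for }t>0 .$$ Suppose that a unique solution $u$ of this problem and its approximation $u_h$ are in $L_\infty(0,t;L_2(\Omega))\cap W^{1,\infty}(\epsilon,t;L_2(\Omega))$ for any $0<\epsilon<t\le T$, and also in $H^1_0(\Omega)$ for any $t>0$, while $u_h(\cdot,0)=u_0$ and $R_h(\cdot,t)=(D_t^\alpha+\mathcal{L})u_h(\cdot,t)-f(\cdot,t)$ for $t>0$. Let $\tau>0$ be an arbitrary parameter, $\beta:=1-\alpha$, and for $t>0$, $s>0$ set $$\mathcal{R}_0(t):=\{\Gamma(1-\alpha)\}^{-1}t^{-\alpha}+\lambda,\qquad \mathcal{R}_1(t):=\{\Gamma(1-\alpha)\}^{-1}t^{-1}\rho(\tau/t)+\lambda\,\mathcal{E}_1(t),$$ $$\mathcal{E}_1(t):=\max\{\tau,t\}^{\alpha-1},\qquad \rho(s):=s^{-\beta}\bigl[1-((1-s)^+)^\beta\bigr].$$ Then $\rho(s)\ge s^{-\beta}\min\{\beta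 s,1\}$ for $s>0$, and the error $e=u_h-u$ satisfies, for $0<t\le T$, $$\|e(\cdot,t)\|\le\sup_{0<s\le t}\left\{\frac{\|R_h(\cdot,s)\|}{\mathcal{R}_0(s)}\right\},\qquad \|e(\cdot,t)\|\le t^{\alpha-1}\sup_{0<s\le t}\left\{\frac{\|R_h(\cdot,s)\|}{\mathcal{R}_1(s)}\right\},$$ and in the second bound the factor $t^{\alpha-1}$ can be replaced by $\mathcal{E}_1(t)$.
   Context: $\langle\cdot,\cdot\rangle$ and $\|\cdot\|$ are the inner product and norm of $L_2(\Omega)$ ($\langle\mathcal{L}v,v\rangle$ being understood as the associated pairing for $v\in H_0^1(\Omega)$). $v^+:=\max\{0,v\}$. The residual $R_h(\cdot,t)$ is understood to be in $L_2(\Omega)$ for $t>0$. $D_t^\alpha$ is the Caputo derivative of order $\alpha$ in time: $D_t^\alpha v(\cdot,t):=\frac1{\Gamma(1-\alpha)}\int_0^t(t-s)^{-\alpha}\,\partial_s v(\cdot,s)\,ds$ for $t>0$. For the less smooth functions considered here (bounded on $(0,t)$ and Lipschitz in time on $[\epsilon,t]$ for each $0<\epsilon<t$, possibly discontinuous at $t=0$), it is understood via the formula obtained by integration by parts: $$\Gamma(1-\alpha)\,D_t^\alpha v(\cdot,t)=t^{-\alpha}\{v(\cdot,t)-v(\cdot,0)\}+\int_0^t\alpha(t-s)^{-\alpha-1}\{v(\cdot,t)-v(\cdot,s)\}\,ds .$$ *)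

(* Defs.v *)
From HB Require Import structures.
From mathcomp Require Import all_boot all_order all_algebra.
From mathcomp Require Import all_classical all_reals all_analysis.

Set Implicit Arguments.
Unset Strict Implicit.
Unset Printing Implicit Defensive.

Import Order.TTheory GRing.Theory Num.Theory.
Import numFieldNormedType.Exports.

Local Open Scope classical_set_scope.
Local Open Scope ring_scope.

(* The library has no measurable structure on row vectors: we take the product
   sigma-algebra, generated by the coordinates, as it does for tuples. *)
Definition rV_display : measure_display. Proof. exact. Qed.

Section measurable_rV.
Variables (R : realType) (n : nat).

Let coord (i : 'I_n) (x : 'rV[R]_n) : measurableTypeR R := x ord0 i.

Let rV_set0 : g_sigma_preimage coord set0.
Proof. exact: sigma_algebra0. Qed.

Let rV_setC A : g_sigma_preimage coord A -> g_sigma_preimage coord (~` A).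
Proof. exact: sigma_algebraC. Qed.

Let rV_bigcup (F : (set 'rV[R]_n)^nat) :
  (forall i, g_sigma_preimage coord (F i)) ->
  g_sigma_preimage coord (\bigcup_i (F i)).
Proof. exact: sigma_algebra_bigcup. Qed.

HB.instance Definition _ := @isMeasurable.Build rV_display
  'rV[R]_n (g_sigma_preimage coord) rV_set0 rV_setC rV_bigcup.

Lemma measurable_coord (i : 'I_n) :
  measurable_fun [set: 'rV[R]_n] (fun x => x ord0 i : measurableTypeR R).
Proof.
move=> _ Y mY; rewrite setTI; apply: sub_sigma_algebra => /=.
rewrite -bigcup_seq/=; exists i => /=; first by rewrite mem_index_enum.
by exists Y => //; rewrite setTI.
Qed.

Lemma measurable_to_rV d (X : measurableType d) (f : X -> 'rV[R]_n) :
  (forall i, measurable_fun setT (fun x => f x ord0 i : measurableTypeR R)) ->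
  measurable_fun setT f.
Proof.
move=> mf _ A mA.
have : g_sigma_preimage (fun i => coord i \o f) `<=` measurable.
  apply: smallest_sub; first exact: sigma_algebra_measurable.
  by rewrite -bigcup_seq; apply: bigcup_sub => i _ B [C mC <-]; exact: mf.
by apply; rewrite g_sigma_preimage_comp; exists A.
Qed.

End measurable_rV.

Section lebesgue_rV.
Variable R : realType.

Definition rV_cons n (p : measurableTypeR R * 'rV[R]_n) : 'rV[R]_n.+1 :=
  \row_i if unlift ord0 i is Some j then p.2 ord0 j else p.1.

Definition rV_uncons n (x : 'rV[R]_n.+1) : measurableTypeR R * 'rV[R]_n :=
  (x ord0 ord0, \row_j x ord0 (lift ord0 j)).

Lemma rV_consK n : cancel (@rV_cons n) (@rV_uncons n).
Proof.
case=> a v; rewrite /rV_uncons /rV_cons !mxE unlift_none /=; congr pair.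
by apply/rowP => j; rewrite !mxE liftK.
Qed.

Lemma measurable_rV_cons n : measurable_fun setT (@rV_cons n).
Proof.
apply: measurable_to_rV => i; rewrite /rV_cons.
under [X in measurable_fun _ X]eq_fun do rewrite mxE.
case: (unlift ord0 i) => [j|]; last exact: measurable_fst.
exact: (measurableT_comp (measurable_coord j) measurable_snd).
Qed.

Lemma measurable_rV_uncons n : measurable_fun setT (@rV_uncons n).
Proof.
apply/measurable_fun_pairP; split; first exact: measurable_coord.
apply: measurable_to_rV => i /=.
under [X in measurable_fun _ X]eq_fun do rewrite mxE.
exact: measurable_coord.
Qed.

HB.instance Definition _ n := isMeasurableFun.Build _ _ _ _
  (@rV_cons n) (@measurable_rV_cons n).

Section step.
Variables (n : nat) (m : {sigma_finite_measure set 'rV[R]_n -> \bar R}).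

Definition lebesgue_rV_step : set 'rV[R]_n.+1 -> \bar R :=
  pushforward (@lebesgue_measure R \x m)%E (@rV_cons n).

Let step0 : lebesgue_rV_step set0 = 0%E. Proof. exact: measure0. Qed.

Let step_ge0 A : (0 <= lebesgue_rV_step A)%E. Proof. exact: measure_ge0. Qed.

Let step_sigma_additive : semi_sigma_additive lebesgue_rV_step.
Proof. exact: measure_semi_sigma_additive. Qed.

HB.instance Definition _ := isMeasure.Build _ _ _ lebesgue_rV_step
  step0 step_ge0 step_sigma_additive.

Let lebesgue_rV_step_sigma_finite : sigma_finite setT lebesgue_rV_step.
Proof.
have /sigma_finiteP[F [TF ndF Foo]] := sigma_finiteT (@lebesgue_measure R).
have /sigma_finiteP[G [TG ndG Goo]] := sigma_finiteT m.
exists (fun k => @rV_uncons n @^-1` (F k `*` G k)).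
  rewrite -preimage_bigcup; apply/esym/seteqP; split=> // x _ /=.
  have [k _ Fk] : (\bigcup_i F i) (rV_uncons x).1 by rewrite -TF.
  have [l _ Gl] : (\bigcup_i G i) (rV_uncons x).2 by rewrite -TG.
  exists (maxn k l) => //; split.
    by move: Fk; exact/subsetPset/ndF/leq_maxl.
  by move: Gl; exact/subsetPset/ndG/leq_maxr.
move=> k; have [mF Fk] := Foo k; have [mG Gk] := Goo k; split.
  by rewrite -[X in measurable X]setTI; apply: measurable_rV_uncons => //;
    exact: measurableX.
rewrite /lebesgue_rV_step /pushforward -comp_preimage.
have -> : @rV_uncons n \o @rV_cons n = id.
  by apply/funext => p /=; rewrite rV_consK.
by rewrite preimage_id product_measure1E// lte_mul_pinfty// ge0_fin_numE.
Qed.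

HB.instance Definition _ := Measure_isSigmaFinite.Build _ _ _
  lebesgue_rV_step lebesgue_rV_step_sigma_finite.

End step.

Fixpoint lebesgue_rV n : {sigma_finite_measure set 'rV[R]_n -> \bar R} :=
  if n is n'.+1 then lebesgue_rV_step (lebesgue_rV n')
  else \d_(0 : 'rV[R]_0).

End lebesgue_rV.

Section spaces.
Variables (R : realType) (d : nat).
Implicit Types (Omega : set 'rV[R]_d) (v w g phi : 'rV[R]_d -> R)
  (gv gw : 'I_d -> 'rV[R]_d -> R).

Definition rV_dot (x y : 'rV[R]_d) : R := \sum_(i < d) x ord0 i * y ord0 i.

(* Near each boundary point, Omega is the part of a ball lying strictly above
   the graph of a Lipschitz function over the hyperplane orthogonal to a unit
   vector nu; gamma is only evaluated on that hyperplane. The norm behind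
   [ball] and [.-lipschitz] is the sup norm. *)
Definition lipschitz_boundary Omega :=
  forall x0, (closure Omega `\` interior Omega) x0 ->
  exists (nu : 'rV[R]_d) (gamma : 'rV[R]_d -> R) (K r : R),
    [/\ rV_dot nu nu = 1, K.-lipschitz gamma, 0 < r &
        forall x, ball x0 r x ->
          (Omega x <-> gamma (x - rV_dot x nu *: nu) < rV_dot x nu)].

Definition bounded_lipschitz_domain Omega :=
  [/\ open Omega, connected Omega, Omega !=set0, bounded_set Omega &
      lipschitz_boundary Omega].

(* Elements of [L_2(Omega)] are represented by functions on R^d, of which only
   the values in Omega matter, and these up to null sets. *)
Definition L2 Omega v : Prop := (v \_ Omega) \in Lfun (lebesgue_rV R d) 2%:E.

Definition Linfty Omega v : Prop :=
  (v \_ Omega) \in Lfun (lebesgue_rV R d) +oo%E.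

Definition ae_eq_in Omega v w :=
  {ae lebesgue_rV R d, forall x, Omega x -> v x = w x}.

Definition dotL2 Omega v w : R :=
  \int[lebesgue_rV R d]_(x in Omega) (v x * w x).

Definition normL2 Omega v : R := Num.sqrt (dotL2 Omega v v).

Definition partial (i : 'I_d) phi : 'rV[R]_d -> R := 'D_(delta_mx ord0 i) phi.

(* [C_c^infty(Omega)]: all iterated partial derivatives, in any order, exist
   and are continuous. *)
Definition test_fun Omega phi :=
  [/\ forall s : seq 'I_d, continuous (foldr partial phi s),
      forall (s : seq 'I_d) (i : 'I_d) x,
        derivable (foldr partial phi s) x (delta_mx ord0 i),
      compact (closure [set x | phi x != 0]) &
      closure [set x | phi x != 0] `<=` Omega].

Definition weak_partial Omega (i : 'I_d) v g :=
  forall phi, test_fun Omega phi ->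
    dotL2 Omega v (partial i phi) = - dotL2 Omega g phi.

(* [H1 Omega v gv]: v is in [H^1(Omega)] with weak gradient gv. The gradient,
   unique up to null sets, is carried along as an argument. *)
Definition H1 Omega v gv :=
  L2 Omega v /\ forall i, L2 Omega (gv i) /\ weak_partial Omega i v (gv i).

(* [H^1_0(Omega)] is the closure of [C_c^infty(Omega)] in [H^1(Omega)]. *)
Definition H10 Omega v gv :=
  H1 Omega v gv /\
  exists phi : nat -> 'rV[R]_d -> R,
    [/\ forall n, test_fun Omega (phi n),
        normL2 Omega (phi n - v) @[n --> \oo] --> 0 &
        forall i, normL2 Omega (partial i (phi n) - gv i) @[n --> \oo] --> 0].

(* L v = - sum_i D_i (sum_j a_ij D_j v + b_i v) + sum_j c_j D_j v + c0 v *)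
Record diff_op := DiffOp {
  op_a : 'I_d -> 'I_d -> 'rV[R]_d -> R;
  op_b : 'I_d -> 'rV[R]_d -> R;
  op_c : 'I_d -> 'rV[R]_d -> R;
  op_c0 : 'rV[R]_d -> R }.

Implicit Type L : diff_op.

Definition elliptic Omega L :=
  [/\ [/\ forall i j, Linfty Omega (op_a L i j),
          forall i, Linfty Omega (op_b L i),
          forall i, Linfty Omega (op_c L i) &
          Linfty Omega (op_c0 L)] &
      exists2 theta : R, 0 < theta &
        {ae lebesgue_rV R d, forall x, Omega x -> forall xi : 'rV[R]_d,
          theta * rV_dot xi xi <=
          \sum_(i < d) \sum_(j < d) op_a L i j x * xi ord0 i * xi ord0 j}].

(* The pairing < L v, w > for v, w in [H^1_0(Omega)] with gradients gv, gw. *)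
Definition pairing Omega L v gv w gw : R :=
  \int[lebesgue_rV R d]_(x in Omega)
    (\sum_(i < d) (\sum_(j < d) op_a L i j x * gv j x + op_b L i x * v x)
                  * gw i x
     + (\sum_(j < d) op_c L j x * gv j x + op_c0 L x * v x) * w x).

End spaces.

Definition Gamma (R : realType) (x : R) : R :=
  \int[@lebesgue_measure R]_(t in `]0, +oo[) (t `^ (x - 1) * expR (- t)).

Section evolution.
Variables (R : realType) (d : nat).
Implicit Types (Omega : set 'rV[R]_d) (L : diff_op R d) (alpha T a b s t : R)
  (f u v Rh : R -> 'rV[R]_d -> R) (g : 'rV[R]_d -> R).

(* g is the integral over A of the [L_2(Omega)]-valued function v, in the weak
   sense; this is the Bochner integral whenever v is Bochner integrable. *)
Definition is_L2_integral Omega (A : set R) v g :=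
  L2 Omega g /\
  forall w, L2 Omega w ->
    (@lebesgue_measure R).-integrable A (fun s => (dotL2 Omega (v s) w)%:E) /\
    dotL2 Omega g w = \int[@lebesgue_measure R]_(s in A) dotL2 Omega (v s) w.

(* g is the Caputo derivative D_t^alpha v(., t), in integrated-by-parts form. *)
Definition is_caputo Omega alpha v t g :=
  exists2 I, is_L2_integral Omega `]0, t[
      (fun s => (alpha * (t - s) `^ (- alpha - 1)) *: (v t - v s)) I &
    g = (Gamma (1 - alpha))^-1 *: (t `^ (- alpha) *: (v t - v 0) + I).

Definition Linfty_L2 Omega a b v :=
  exists M : R, forall s, a < s < b -> normL2 Omega (v s) <= M.

(* [W^{1,infty}(a, b; L_2(Omega))], as the Lipschitz functions on [a, b]. *)
Definition W1infty_L2 Omega a b v :=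
  exists K : R, forall s t, a <= s <= b -> a <= t <= b ->
    normL2 Omega (v s - v t) <= K * `|s - t|.

Definition admissible Omega T v :=
  [/\ forall t, 0 <= t <= T -> L2 Omega (v t),
      forall e t, 0 < e -> e < t -> t <= T ->
        Linfty_L2 Omega 0 t v /\ W1infty_L2 Omega e t v &
      forall t, 0 < t <= T -> exists gv, H10 Omega (v t) gv].

(* r = (D_t^alpha + L) v(., t) - f(., t), an identity between functionals on
   [H^1_0(Omega)]. *)
Definition is_residual Omega L alpha f v t r :=
  exists D gv,
    [/\ is_caputo Omega alpha v t D, H10 Omega (v t) gv &
        forall w gw, H10 Omega w gw ->
          dotL2 Omega r w =
          dotL2 Omega D w + pairing Omega L (v t) gv w gw
          - dotL2 Omega (f t) w].

Definition is_solution Omega L alpha T f (u0 : 'rV[R]_d -> R) u :=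
  [/\ admissible Omega T u, ae_eq_in Omega (u 0) u0 &
      forall t, 0 < t <= T -> is_residual Omega L alpha f u t (cst 0)].

Definition is_unique_solution Omega L alpha T f (u0 : 'rV[R]_d -> R) u :=
  is_solution Omega L alpha T f u0 u /\
  forall v, is_solution Omega L alpha T f u0 v ->
    forall t, 0 <= t <= T -> ae_eq_in Omega (v t) (u t).

End evolution.

Section weights.
Variable R : realType.
Implicit Types alpha beta lambda tau s t : R.

Definition rho beta s : R :=
  s `^ (- beta) * (1 - (Num.max 0 (1 - s)) `^ beta).

Definition calE1 alpha tau t : R := (Num.max tau t) `^ (alpha - 1).

Definition calR0 alpha lambda t : R :=
  (Gamma (1 - alpha))^-1 * t `^ (- alpha) + lambda.

Definition calR1 alpha lambda tau t : R :=
  (Gamma (1 - alpha))^-1 * t^-1 * rho (1 - alpha) (tau / t)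
  + lambda * calE1 alpha tau t.

Definition sup_upto t (g : R -> R) : \bar R :=
  ereal_sup [set (g s)%:E | s in `]0, t] ].

End weights.

(* Main.v *)
(* Testing the difference of the two residual identities with e(t) and using
   coercivity bounds the Caputo operator applied to the scalar function
   y(t) = |e(t)|: by Cauchy-Schwarz,
     <D_t^alpha e(t), e(t)> >= y(t) D_t^alpha y(t),
   with the value 0 for y at t = 0. Then y is compared with the barrier
   B(s) = M E_1(s) + delta s^(alpha-1): the operator annihilates s^(alpha-1)
   and maps E_1 to t^-1 rho(tau/t) / Gamma(1-alpha), so that at a positive
   maximum of y - B the residual would exceed M R_1. Since B blows up at 0, the
   maximum is attained although y may jump there; finally delta tends to 0. This
   is the bound with factor E_1; since E_1(t) <= t^(alpha-1) it implies the one
   with t^(alpha-1), and for tau = t it is the bound with R_0, because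
   R_1(s) = t^(alpha-1) R_0(s) for s <= t when tau = t. *)

Require Import Defs.
From mathcomp Require Import all_boot all_order all_algebra.
From mathcomp Require Import all_classical all_reals all_analysis.
From mathcomp Require Import ess_sup_inf measurable_realfun ring lra.

Set Implicit Arguments.
Unset Strict Implicit.
Unset Printing Implicit Defensive.

Import Order.TTheory GRing.Theory Num.Theory.
Import numFieldNormedType.Exports.

Local Open Scope classical_set_scope.
Local Open Scope ring_scope.

(** * Integrals over open intervals *)

(** Dominated convergence for the restrictions of [phi] to [A n], with majorant [|phi|]: each point
    of [D] lies in [A n] from some index on. *)
Lemma cvg_Rintegral_exhaust d (T : measurableType d) (R : realType)
    (mu : {measure set T -> \bar R}) (D : set T) (A : (set T)^nat) (phi : T -> R) :
  measurable D -> (forall n, measurable (A n)) -> (forall n, A n `<=` D) ->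
  (forall x, D x -> \forall n \near \oo, A n x) ->
  mu.-integrable D (EFin \o phi) ->
  \int[mu]_(x in A n) phi x @[n --> \oo] --> \int[mu]_(x in D) phi x.
Proof.
move=> mD mA AD exh iphi; have mphi := measurable_int mu iphi.
have iA n : mu.-integrable (A n) (EFin \o phi) by exact: integrableS iphi.
apply: fine_cvg; rewrite /= fineK; last exact: integrable_fin_num.
have [|||||_ _] := @dominated_convergence _ _ _ mu D mD
    (fun n => (EFin \o phi) \_ (A n)) (EFin \o phi) (abse \o (EFin \o phi)).
- by move=> n; apply/measurable_restrict => //; apply: measurable_funS mphi.
- exact: mphi.
- apply: aeW => x /exh xA; apply: cvg_near_cst.
  by apply: filterS xA => n xAn; rewrite patchE mem_set.
- exact: integrable_abse.
- apply: aeW => x n _; rewrite patchE; case: ifP => // _; rewrite abse0.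
  exact: abse_ge0.
under eq_fun do rewrite -integral_mkcondr setIC (setIidl (@AD _)).
by [].
Qed.

Section real_integrals.
Variable R : realType.
Implicit Types p q a b x K : R.
Notation mu := (@lebesgue_measure R).

(** The increment of [F] is the integral of the continuous [f], which lies below [phi]. Regularity
    is thus asked of the explicit minorant only, while [phi] is merely integrable. *)
Lemma FTC2_le (f F phi : R -> R) a b : a < b ->
  (forall x, a <= x <= b -> is_derive x (1 : R) F (f x)) ->
  (forall x, a <= x <= b -> {for x, continuous f}) ->
  mu.-integrable `[a, b] (EFin \o phi) ->
  (forall x, a <= x <= b -> f x <= phi x) ->
  F b - F a <= \int[mu]_(x in `[a, b]) phi x.
Proof.
move=> ab dF cf iphi fphi.
have cfab : {within `[a, b], continuous f}.
  apply: continuous_in_subspaceT => x; rewrite inE/= in_itv/=; exact: cf.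
have cF x : a <= x <= b -> {for x, continuous F}.
  move=> xab; apply/differentiable_continuous/derivable1_diffP.
  by have [] := dF x xab.
have FTC : (\int[mu]_(x in `[a, b]) (f x)%:E = (F b)%:E - (F a)%:E)%E.
  apply: continuous_FTC2 => //.
    split=> [x /[!in_itv]/= /andP[/ltW ax /ltW xb]||].
    - by have [|] := dF x; rewrite ?ax.
    - by apply: cvg_at_right_filter; apply: cF; rewrite lexx ltW.
    - by apply: cvg_at_left_filter; apply: cF; rewrite lexx ltW.
  move=> x /[!in_itv]/= /andP[/ltW ax /ltW xb].
  by rewrite derive1E; have [|_ ->] := dF x; rewrite ?ax.
have <- : \int[mu]_(x in `[a, b]) f x = F b - F a by rewrite /Rintegral FTC.
apply: le_Rintegral => //.
apply: continuous_compact_integrable => //; exact: segment_compact.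
Qed.

(** The factor 1/3 makes the closed subinterval nondegenerate already for [n = 0]. *)
Lemma itvoo_exhaust p q x : p < x < q ->
  \forall n \near \oo, p + (q - p) / 3 / n.+1%:R <= x
                       <= q - (q - p) / 3 / n.+1%:R.
Proof.
move=> /andP[px xq]; have pq : 0 < (q - p) / 3 by lra.
pose e := Num.min (x - p) (q - x) / ((q - p) / 3).
have e0 : 0 < e by rewrite divr_gt0// lt_min !subr_gt0 px.
near=> n.
have : n.+1%:R^-1 <= e.
  by apply/ltW; near: n; exact: near_infty_natSinv_lt (PosNum e0).
rewrite /e ler_pdivlMr// le_min (mulrC _^-1) => /andP[hx hq].
by apply/andP; split; [rewrite -lerBrDl | rewrite lerBrDr -lerBrDl].
Unshelve. all: by end_near. Qed.

(* FTC is only used on compact subintervals: F and f may blow up at the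
   endpoints, the integrability of phi does the limit. *)
Lemma integral_itvoo_ge (f F phi : R -> R) p q K : p < q ->
  (forall x, p < x < q -> is_derive x (1 : R) F (f x)) ->
  (forall x, p < x < q -> {for x, continuous f}) ->
  mu.-integrable `]p, q[ (EFin \o phi) ->
  (forall x, p < x < q -> f x <= phi x) ->
  (forall a b, p < a -> a < b -> b < q -> K <= F b - F a) ->
  K <= \int[mu]_(x in `]p, q[) phi x.
Proof.
move=> pq dF cf iphi fphi KF.
pose h n : R := (q - p) / 3 / n.+1%:R.
have h0 n : 0 < h n by rewrite divr_gt0//; lra.
have h1 n : h n <= (q - p) / 3.
  by rewrite /h ler_pdivrMr ?ltr0n// ler_peMr ?ler1n//; lra.
pose A n := [set` `[p + h n, q - h n] ].
have Asub n : A n `<=` `]p, q[.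
  move=> x; rewrite /A/= !in_itv/=; have := h0 n; lra.
have iphiA n : mu.-integrable (A n) (EFin \o phi).
  by apply: integrableS iphi => //; exact: measurable_itv.
have KA n : K <= \int[mu]_(x in A n) phi x.
  have hn0 := h0 n; have hn1 := h1 n.
  apply: (@le_trans _ _ (F (q - h n) - F (p + h n))).
    by apply: KF; lra.
  apply: (@FTC2_le f) => [|x xA|x xA||x xA]; [lra|apply: dF; lra|apply: cf; lra|
    exact: iphiA|apply: fphi; lra].
have lim : \int[mu]_(x in A n) phi x @[n --> \oo] --> \int[mu]_(x in `]p, q[) phi x.
  apply: cvg_Rintegral_exhaust => //=.
  - by move=> m; exact: measurable_itv.
  - by move=> x /=; rewrite in_itv/= => /itvoo_exhaust; apply: filterS => m; rewrite /A/= in_itv.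
by apply: (cvgr_to_ge lim); apply: nearW.
Qed.

End real_integrals.

(** * Powers, Gamma and rho *)

Section weights.
Variable R : realType.
Implicit Types x s t b : R.
Notation mu := (@lebesgue_measure R).

Lemma rho_ge b s : 0 < b < 1 -> 0 < s ->
  s `^ (- b) * Num.min (b * s) 1 <= rho b s.
Proof.
move=> /andP[b0 b1] s0; rewrite /rho ler_wpM2l ?powR_ge0//.
have [s1|s1] := leP 1 s.
  have -> : Num.max 0 (1 - s) = 0 by apply/max_idPl; rewrite subr_le0.
  by rewrite powR0 ?gt_eqF// subr0 ge_min lexx orbT.
have -> : Num.max 0 (1 - s) = 1 - s by apply/max_idPr; rewrite subr_ge0 ltW.
rewrite ge_min; apply/orP; left.
(* Bernoulli's inequality, as Young's with exponents 1/b and 1/(1-b) *)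
have b1V : 0 < (1 - b)^-1 by rewrite invr_gt0 subr_gt0.
have bV : 0 < b^-1 by rewrite invr_gt0.
have := conjugate_powR (powR_ge0 (1 - s) b) ler01 bV b1V.
rewrite !invrK addrC subrK => /(_ erefl).
rewrite powR1 -powRrM mulfV ?gt_eqF// powRr1; last by rewrite subr_ge0 ltW.
lra.
Qed.

Lemma rho_gt0 b s : 0 < b < 1 -> 0 < s -> 0 < rho b s.
Proof.
move=> b01 s0; apply: lt_le_trans (rho_ge b01 s0).
by rewrite mulr_gt0 ?powR_gt0// lt_min ltr01 andbT mulr_gt0//; case/andP: b01.
Qed.

(** The majorant is chosen for its explicit primitive. It dominates because
    $(1+t)^{x+1}\le(1+t)^2\le4(1+t/2)^2\le4e^t$. *)
Lemma Gamma_integrand_le x t : 0 < x <= 1 -> 0 < t ->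
  t `^ (x - 1) * expR (- t) <= 4 * (t `^ (x - 1) * (1 + t) `^ (- x - 1)).
Proof.
move=> /andP[x0 x1] t0; rewrite mulrCA ler_wpM2l ?powR_ge0//.
have t1 : 0 < 1 + t by lra.
have -> : - x - 1 = - (x + 1) by ring.
rewrite powRN expRN -ler_pdivrMr ?invr_gt0 ?powR_gt0// invrK.
rewrite mulrC ler_pdivrMr ?expR_gt0//.
apply: (@le_trans _ _ ((1 + t) `^ 2%:R)); first by apply: ler_powR; lra.
rewrite powR_mulrn ?ltW//.
have e2 : 1 + t / 2 <= expR (t / 2) by exact: expR_ge1Dx.
have -> : expR t = expR (t / 2) ^+ 2 by rewrite expr2 -expRD; congr expR; field.
have := expR_gt0 (t / 2).
nra.
Qed.

Lemma le0_ger_powR a x y : a <= 0 -> 0 < x -> x <= y -> y `^ a <= x `^ a.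
Proof.
move=> a0 x0 xy; have y0 := lt_le_trans x0 xy.
rewrite -[a]opprK !(powRN _ (- a)) lef_pV2 ?posrE ?powR_gt0//.
by apply: ge0_ler_powR; rewrite ?nnegrE ?oppr_ge0// ltW.
Qed.

Lemma powRB1K a x : 0 < x -> x `^ (a - 1) * x = x `^ a.
Proof.
move=> x0; rewrite -[X in _ * X]powRr1 ?ltW// -powRD ?subrK//.
by rewrite (gt_eqF x0) implybT.
Qed.

Lemma is_derive_powRD a b x : 0 < a + x ->
  is_derive x (1 : R) (fun y => (a + y) `^ b) (b * (a + x) `^ (b - 1)).
Proof.
move=> ax; have d := @is_derive1_powR _ b _ ax.
have d' : is_derive x (1 : R) (fun y => a + y) 1.
  rewrite -[X in is_derive _ _ _ X](add0r (1 : R)).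
  exact: is_deriveD (is_derive_cst a x 1) (is_derive_id x 1).
by have := is_derive1_comp d d'; rewrite mulr1.
Qed.

Lemma is_derive_powRB a b x : 0 < a - x ->
  is_derive x (1 : R) (fun y => (a - y) `^ b) (- b * (a - x) `^ (b - 1)).
Proof.
move=> ax; have d := @is_derive1_powR _ b _ ax.
have d' : is_derive x (1 : R) (fun y => a - y) (- 1).
  rewrite -[X in is_derive _ _ _ X](add0r (- 1 : R)).
  exact: is_deriveB (is_derive_cst a x 1) (is_derive_id x 1).
by have := @is_derive1_comp R (fun y => y `^ b) (fun y => a - y) x _ _ d d';
  rewrite mulrN1 mulNr.
Qed.

Lemma continuous_powR a x : 0 < x -> {for x, continuous (fun y : R => y `^ a)}.
Proof.
move=> x0; apply/differentiable_continuous/derivable1_diffP.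
by have [] := is_derive1_powR a x0.
Qed.

Lemma continuous_powRD a b x : 0 < a + x ->
  {for x, continuous (fun y => (a + y) `^ b)}.
Proof.
move=> x0; apply/differentiable_continuous/derivable1_diffP.
by have [] := is_derive_powRD b x0.
Qed.

Lemma continuous_powRB a b x : 0 < a - x ->
  {for x, continuous (fun y => (a - y) `^ b)}.
Proof.
move=> x0; apply/differentiable_continuous/derivable1_diffP.
by have [] := is_derive_powRB b x0.
Qed.

(** This is $(t/(1+t))^x$ for $t>0$, with values in $[0,1]$; up to the factor $4/x$ it is a
    primitive of the majorant of the Gamma integrand. *)
Let H x t : R := t `^ x * (1 + t) `^ (- x).

Lemma is_derive_Gamma_majorant x t : 0 < t ->
  is_derive t (1 : R) (H x) (x * (t `^ (x - 1) * (1 + t) `^ (- x - 1))).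
Proof.
move=> t0; rewrite /H; have t1 : 0 < 1 + t by lra.
have d1 := is_derive1_powR x t0.
have d2 : is_derive t (1 : R) (fun t => (1 + t) `^ (- x))
    (- x * (1 + t) `^ (- x - 1)).
  exact: is_derive_powRD.
suff <- : t `^ x * (- x * (1 + t) `^ (- x - 1)) +
    (1 + t) `^ (- x) * (x * t `^ (x - 1)) =
    x * (t `^ (x - 1) * (1 + t) `^ (- x - 1)) by exact: (is_deriveM d1 d2).
rewrite -(powRB1K x t0) -(powRB1K (- x) t1).
ring.
Qed.

Let g x t : R := t `^ (x - 1) * expR (- t).

Let cg x t : 0 < t -> {for t, continuous (g x)}.
Proof.
move=> t0; apply: continuousM; first exact: continuous_powR.
apply: continuous_comp; first exact: opp_continuous.
exact: continuous_expR.
Qed.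

Let ig x a b : 0 < a -> mu.-integrable `[a, b] (EFin \o g x).
Proof.
move=> a0; apply: continuous_compact_integrable; first exact: segment_compact.
apply: continuous_in_subspaceT => t; rewrite inE/= in_itv/= => /andP[at_ _].
by apply: cg; exact: lt_le_trans at_.
Qed.

(** [Gamma] is the real part [fine] of an extended integral, so its value is meaningful once that
    integral is finite. On compact intervals the primitive $(4/x)H$ of the majorant gives the bound
    $4/x$, and monotone convergence carries it to the half line. *)
Lemma Gamma_integral_lty x : 0 < x <= 1 ->
  (\int[mu]_(t in `]0%R, +oo[) (t `^ (x - 1) * expR (- t))%:E < +oo)%E.
Proof.
move=> x01; have /andP[x0 x1] := x01.
have xn0 : x != 0 by rewrite gt_eqF.
(* Starting from 2 keeps the endpoints strictly ordered for [n = 0]. *)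
pose F n := [set` `[(n.+2%:R : R)^-1, n.+2%:R] ].
have UF : \bigcup_n F n = [set` `]0, +oo[ ].
  apply/seteqP; split => [t [n _]|t]; rewrite /F/= !in_itv/= andbT.
    by move=> /andP[+ _]; apply: lt_le_trans; rewrite invr_gt0.
  move=> t0; exists (Num.truncn (Num.max t t^-1)) => //=; rewrite in_itv/=.
  have := truncnS_gt (Num.max t t^-1).
  rewrite gt_max => /andP[ht ht'].
  have le12 : ((Num.truncn (Num.max t t^-1)).+1%:R : R) <=
    (Num.truncn (Num.max t t^-1)).+2%:R by rewrite ler_nat.
  rewrite (le_trans (ltW ht) le12) andbT.
  by rewrite invf_ple ?posrE// (le_trans (ltW ht') le12).
have Fpos n t : F n t -> 0 < t.
  by rewrite /F/= in_itv/= => /andP[+ _]; apply: lt_le_trans; rewrite invr_gt0.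
have lim : (\int[mu]_(t in F n) (g x t)%:E)%E @[n --> \oo]
    --> (\int[mu]_(t in \bigcup_n F n) (g x t)%:E)%E.
  apply: ge0_nondecreasing_set_cvg_integral => //.
  - apply/nondecreasing_seqP => n; rewrite subsetEset; apply: subset_itv;
      rewrite bnd_simp ?lef_pV2 ?posrE// ler_nat//.
  - by move=> n; exact: measurable_itv.
  - by move=> n; apply: measurable_int (ig _ _ _); rewrite invr_gt0.
  - by move=> n t _; rewrite lee_fin mulr_ge0 ?powR_ge0 ?expR_ge0.
rewrite -UF; apply: (@le_lt_trans _ _ (4 / x)%:E); last exact: ltry.
apply: (cvge_to_le lim); apply: nearW => n.
have igF : mu.-integrable (F n) (EFin \o g x) by apply: ig; rewrite invr_gt0.
have n1 : (n.+2%:R : R)^-1 < n.+2%:R.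
  by apply: (@lt_trans _ _ 1); rewrite ?invf_lt1 ?ltr0n ?ltr1n.
rewrite -[leLHS]fineK; last by apply: integrable_fin_num => //; exact: measurable_itv.
rewrite lee_fin.
have H0 t : 0 < t -> 0 <= H x t <= 1.
  move=> t0; rewrite /H mulr_ge0 ?powR_ge0//= powRN ler_pdivrMr; last first.
    by rewrite powR_gt0//; lra.
  by rewrite mul1r; apply: ge0_ler_powR; rewrite ?nnegrE; lra.
(* [FTC2_le] bounds integrals from below; the upper bound is obtained by applying it to the
   negatives. *)
have igN : mu.-integrable (F n) (EFin \o (fun t => - g x t)).
  exact: integrableN igF.
have := @FTC2_le R (fun t => - (4 * (t `^ (x - 1) * (1 + t) `^ (- x - 1))))
  (fun t => - (4 / x * H x t)) (fun t => - g x t) _ _ n1 _ _ igN.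
have -> : \int[mu]_(t in `[n.+2%:R^-1, n.+2%:R]) (- g x t) =
    - \int[mu]_(t in F n) g x t.
  by under eq_Rintegral do rewrite -mulN1r; rewrite RintegralZl ?mulN1r.
have /H0 : (0 : R) < n.+2%:R^-1 by rewrite invr_gt0.
have /H0 : (0 : R) < n.+2%:R by [].
set H1 := H x _; set H2 := H x _ => H1P H2P le.
have {}le : 4 / x * H2 - 4 / x * H1 <= - \int[mu]_(t in F n) g x t.
  have pos t : n.+2%:R^-1 <= t <= n.+2%:R -> 0 < t.
    by move=> /andP[+ _]; apply: lt_le_trans; rewrite invr_gt0.
  rewrite -[X in X - _]opprK addrC; apply: le => t /pos t0.
  - have := is_deriveN (is_deriveZ (4 / x) (is_derive_Gamma_majorant x t0)).
    by rewrite /GRing.scale/= !mulrA mulfVK.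
  - apply: continuousN; apply: continuousM; first exact: cst_continuous.
    by apply: continuousM; [exact: continuous_powR|apply: continuous_powRD; lra].
  - by rewrite lerN2 /g Gamma_integrand_le.
have x4 : 0 < 4 / x by rewrite divr_gt0.
rewrite /Rintegral/= in le; nra.
Qed.

(** On $[1,2]$ the integrand is at least $e^{-2}/2$, since $t^{x-1}\ge t^{-1}\ge1/2$ there. *)
Lemma Gamma_gt0 x : 0 < x <= 1 -> 0 < Gamma x.
Proof.
move=> x01; have /andP[x0 x1] := x01.
apply: (@lt_le_trans _ _ (expR (- 2) / 2)).
  by rewrite divr_gt0// expR_gt0.
apply: (@le_trans _ _ (\int[mu]_(t in `[1, 2]) g x t)).
  have := @FTC2_le R (cst (expR (- 2) / 2)) (fun t => expR (- 2) / 2 * t) (g x) 1 2.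
  have -> : expR (- 2) / 2 * 2 - expR (- 2) / 2 * 1 = expR (- 2) / 2 :> R by field.
  apply.
  - lra.
  - by move=> t _; rewrite -[X in is_derive _ _ _ X](mulr1 (_ / _));
      exact: (is_deriveZ (expR (- 2) / 2) (is_derive_id t 1)).
  - by move=> t _; exact: cst_continuous.
  - exact: ig.
  - move=> t /andP[t1 t2]; rewrite /g/= mulrC ler_pM ?invr_ge0 ?expR_ge0//.
      apply: (@le_trans _ _ (t `^ (- 1))); last by apply: ler_powR; lra.
      rewrite powR_inv1; last lra.
      by rewrite lef_pV2// posrE; lra.
    by rewrite ler_expR; lra.
rewrite /Gamma /Rintegral fine_le//.
- exact: integrable_fin_num (ig _ _ _).
- rewrite ge0_fin_numE ?Gamma_integral_lty//.
  by apply: integral_ge0 => t _; rewrite lee_fin mulr_ge0 ?powR_ge0 ?expR_ge0.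
- apply: ge0_subset_integral => //.
  + apply/measurable_EFinP/measurable_funTS; apply: measurable_funM.
      exact: measurable_powR.
    by apply: measurableT_comp => //; exact: measurable_funN.
  + by move=> t _; rewrite lee_fin mulr_ge0 ?powR_ge0 ?expR_ge0.
  + move=> t /=; rewrite !in_itv/= => /andP[t1 _]; rewrite andbT; exact: lt_le_trans t1.
Qed.

End weights.

(** * The Caputo operator on the barrier *)

Section caputo_barrier.
Variable R : realType.
Implicit Types al s t p q A C M de tau : R.
Notation mu := (@lebesgue_measure R).

(** On either side of $\tau$ the increment $B(t)-B(s)$ of the barrier has the form
    $A-Cs^{\alpha-1}$, so this one primitive of kernel times increment serves for both pieces. *)
Let F al t A C s : R := (t - s) `^ (- al) * (A - C / t * s `^ al).

(* [(s / (t - s)) ^ al / t] is a primitive of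
   [al (t - s) ^ (- al - 1) s ^ (al - 1)]. *)
Lemma is_derive_kernel_primitive al t A C s : 0 < s < t ->
  is_derive s (1 : R) (F al t A C)
    (al * (t - s) `^ (- al - 1) * (A - C * s `^ (al - 1))).
Proof.
move=> /andP[s0 st]; rewrite /F.
have ts : 0 < t - s by rewrite subr_gt0.
have d1 := is_derive_powRB (- al) ts.
have d2 := is_derive1_powR al s0.
have d3 : is_derive s (1 : R) (fun s => A - C / t * s `^ al)
    (0 - C / t * (al * s `^ (al - 1))).
  exact: is_deriveB (is_derive_cst A s 1) (is_deriveZ (C / t) d2).
suff <- : (t - s) `^ (- al) * (0 - C / t * (al * s `^ (al - 1))) +
    (A - C / t * s `^ al) * (- - al * (t - s) `^ (- al - 1)) =
    al * (t - s) `^ (- al - 1) * (A - C * s `^ (al - 1))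
  by exact: (is_deriveM d1 d3).
rewrite -(powRB1K (- al) ts) -(powRB1K al s0).
have t0 : t != 0 by rewrite gt_eqF// (lt_trans s0).
by field.
Qed.

(** The derivative has the sign of $A-Cs^{\alpha-1}\le0$. Monotonicity gives
    [F q - F p <= F b - F a] for [p < a < b < q], which is the form in which [integral_itvoo_ge]
    takes its endpoint condition. *)
Lemma kernel_primitive_nincr al t A C q a b : 0 < al -> 0 < a -> b < t ->
  (forall s, 0 < s < q -> A <= C * s `^ (al - 1)) -> a <= b -> b <= q ->
  F al t A C b <= F al t A C a.
Proof.
move=> al0 a0 bt AC ab bq.
have dF s : a <= s <= b -> is_derive s (1 : R) (F al t A C)
    (al * (t - s) `^ (- al - 1) * (A - C * s `^ (al - 1))).
  by move=> /andP[as_ sb]; apply: is_derive_kernel_primitive; lra.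
apply: (@ler0_derive1_le_cc R _ a b) => //.
- move=> s; rewrite in_itv/= => /andP[as_ sb].
  by have [|] := dF s; rewrite ?ltW.
- move=> s; rewrite in_itv/= => /andP[as_ sb].
  rewrite derive1E; have [|_ ->] := dF s; first by rewrite !ltW.
  rewrite mulr_ge0_le0 ?mulr_ge0 ?powR_ge0 ?(ltW al0)// subr_le0 AC//; lra.
- apply: continuous_in_subspaceT => s; rewrite inE/= in_itv/= => /dF[+ _].
  by move=> ?; apply/differentiable_continuous/derivable1_diffP.
- by rewrite in_itv/= lexx ab.
- by rewrite in_itv/= lexx ab.
Qed.

(** The derivative is singular at 0, but [F] is right-continuous there because $s^\alpha\to0$, so
    monotonicity passes to the endpoint. *)
Lemma kernel_primitive_le0 al t A C q a : 0 < al -> 0 < a -> a < t ->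
  (forall s, 0 < s < q -> A <= C * s `^ (al - 1)) -> a <= q ->
  F al t A C a <= F al t A C 0.
Proof.
move=> al0 a0 at_ AC aq.
have lim : F al t A C x @[x --> 0^'+] --> F al t A C 0.
  rewrite {2}/F powR0 ?gt_eqF//; apply: cvgM.
    apply: cvg_at_right_filter; apply: continuous_powRB; lra.
  apply: cvgB; first exact: cvg_cst.
  by apply: cvgM; [exact: cvg_cst|exact: powR_cvg0].
apply: (cvgr_to_ge lim); near=> x; apply: kernel_primitive_nincr AC _ _ => //.
by near: x; exact: nbhs_right_le.
Unshelve. all: by end_near. Qed.

Lemma integral_kernel_ge al t A C p q phi :
  0 < al -> 0 <= p -> p < q -> q < t \/ [/\ q = t, 0 <= C & A = C * t `^ (al - 1)] ->
  (forall s, 0 < s < q -> A <= C * s `^ (al - 1)) ->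
  mu.-integrable `]p, q[ (EFin \o phi) ->
  (forall s, p < s < q ->
    al * (t - s) `^ (- al - 1) * (A - C * s `^ (al - 1)) <= phi s) ->
  F al t A C q - F al t A C p <= \int[mu]_(s in `]p, q[) phi s.
Proof.
move=> al0 p0 pq qtC AC iphi phige.
have qt : q <= t by case: qtC => [/ltW //|[->]].
apply: (@integral_itvoo_ge R _ (F al t A C) _ _ _ _ pq _ _ iphi phige).
- by move=> s /andP[ps sq]; apply: is_derive_kernel_primitive; lra.
- move=> s /andP[ps sq]; apply: continuousM.
    by apply: continuousM; [exact: cst_continuous|apply: continuous_powRB; lra].
  apply: continuousB; first exact: cst_continuous.
  by apply: continuousM; [exact: cst_continuous|apply: continuous_powR; lra].
move=> a b pa ab bq; apply: lerB.
  (* At [q = t] the kernel power is singular. The convention that 0 to a nonzero power is 0 gives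
     [F t = 0], so [0 <= F b] remains; it holds because the second factor is
     $(C/t)(t^\alpha-b^\alpha)$. *)
  case: qtC => [qt'|[-> C0 ->]]; first by apply: kernel_primitive_nincr AC _ _; lra.
  rewrite {1}/F subrr powR0 ?oppr_eq0 ?gt_eqF// mul0r /F mulr_ge0 ?powR_ge0//.
  have t0 : 0 < t by lra.
  have b0 : 0 < b by lra.
  have bt : b <= t by lra.
  have -> : t `^ (al - 1) = t `^ al / t by rewrite -(powRB1K al t0) mulfK// gt_eqF.
  have -> : C * (t `^ al / t) - C / t * b `^ al = C / t * (t `^ al - b `^ al) by ring.
  rewrite mulr_ge0 ?divr_ge0 ?(ltW t0)// subr_ge0.
  by apply: ge0_ler_powR; rewrite ?nnegrE//; exact: ltW.
have [p0'|p0'] := ltP 0 p; first by apply: kernel_primitive_nincr AC _ _; lra.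
have -> : p = 0 by lra.
by apply: kernel_primitive_le0 AC _; lra.
Qed.

(** This brings the weight into the shape produced by the primitive [F] at its endpoints $0$ and
    $\tau$. *)
Lemma rho_scale al tau t : 0 < al < 1 -> 0 < tau -> 0 < t ->
  t^-1 * rho (1 - al) (tau / t) =
  tau `^ (al - 1) * (t `^ (- al) - t^-1 * (Num.max 0 (t - tau)) `^ (1 - al)).
Proof.
move=> al01 tau0 t0; have tn0 : t != 0 by rewrite gt_eqF.
have invP a : (t^-1) `^ a = t `^ (- a).
  by rewrite -powR_inv1 ?ltW// -powRrM mulN1r.
rewrite /rho.
have -> : Num.max 0 (1 - tau / t) = Num.max 0 (t - tau) / t.
  by rewrite maxr_pMl ?invr_ge0 ?ltW// mul0r mulrBl divff.
have tV : 0 <= t^-1 by rewrite invr_ge0 ltW.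
have max0 : 0 <= Num.max 0 (t - tau) by rewrite le_max lexx.
rewrite (powRM _ (ltW tau0) tV) (powRM _ max0 tV) !invP opprK opprB.
have tE : t `^ (1 - al) = t * t `^ (- al).
  by rewrite addrC -(powRB1K (- al + 1) t0) addrK mulrC.
have tE' : t `^ (al - 1) * t `^ (1 - al) = 1.
  rewrite -powRD; last by rewrite (negbTE tn0) implybT.
  have -> : al - 1 + (1 - al) = 0 by ring.
  by rewrite powRr0.
set X := tau `^ _; set m := (Num.max _ _) `^ _.
transitivity (t^-1 * X * (t `^ (1 - al) - m * (t `^ (al - 1) * t `^ (1 - al)))).
  by ring.
by rewrite tE' tE; field.
Qed.

Definition barrier al tau M de s : R := M * calE1 al tau s + de * s `^ (al - 1).

(** With $t^{-\alpha}B(t)$ moved to the right, this bounds $\Gamma(1-\alpha)$ times the Caputo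
    operator on $B$, with value 0 at time 0, from below by $M t^{-1}\rho(\tau/t)$. Integrability is
    asked of the majorant [phi] instead of the barrier's own integrand. For $t\le\tau$ only the
    $\delta$ term varies; otherwise the integral is split at $\tau$. *)
Lemma barrier_integral_ge al tau t M de phi :
  0 < al < 1 -> 0 < tau -> 0 < t -> 0 <= M -> 0 <= de ->
  mu.-integrable `]0, t[ (EFin \o phi) ->
  (forall s, 0 < s < t ->
    al * (t - s) `^ (- al - 1) * (barrier al tau M de t - barrier al tau M de s)
    <= phi s) ->
  M * (t^-1 * rho (1 - al) (tau / t)) - t `^ (- al) * barrier al tau M de t
  <= \int[mu]_(s in `]0, t[) phi s.
Proof.
move=> al01 tau0 t0 M0 de0 iphi phige; have /andP[al0 al1] := al01.
have pow_le a b : 0 < a -> a <= b -> b `^ (al - 1) <= a `^ (al - 1).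
  by apply: le0_ger_powR; lra.
have E1le s : s <= tau -> calE1 al tau s = tau `^ (al - 1).
  by move=> stau; rewrite /calE1; congr (_ `^ _); apply/max_idPl.
have E1ge s : tau <= s -> calE1 al tau s = s `^ (al - 1).
  by move=> stau; rewrite /calE1; congr (_ `^ _); apply/max_idPr.
have F0 A C : F al t A C 0 = t `^ (- al) * A.
  by rewrite /F subr0 powR0 ?gt_eqF// mulr0 subr0.
have Ft A C : F al t A C t = 0.
  by rewrite /F subrr powR0 ?oppr_eq0 ?gt_eqF// mul0r.
rewrite rho_scale//; have [ttau|taut] := leP t tau.
  have -> : Num.max 0 (t - tau) = 0 by apply/max_idPl; rewrite subr_le0.
  rewrite powR0 ?subr_eq0; last by rewrite gt_eqF.
  have := @integral_kernel_ge al t (de * t `^ (al - 1)) de 0 t phi al0 (lexx _) t0.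
  rewrite F0 Ft => le; apply: le_trans (le _ _ iphi _) => {le}.
  - by rewrite /barrier E1le// le_eqVlt; apply/orP; left; apply/eqP; ring.
  - by right.
  - by move=> s /andP[s0 st]; rewrite ler_wpM2l// pow_le// ltW.
  - move=> s st; apply: le_trans (phige _ st).
    have /andP[s0 st'] := st.
    rewrite /barrier !E1le ?(le_trans (ltW st'))//.
    by rewrite le_eqVlt; apply/orP; left; apply/eqP; ring.
have -> : Num.max 0 (t - tau) = t - tau by apply/max_idPr; rewrite subr_ge0 ltW.
have ttau0 : 0 < t - tau by rewrite subr_gt0.
have i1 : mu.-integrable `]0, tau[ (EFin \o phi).
  apply: integrableS iphi => //; try exact: measurable_itv.
  by apply: subset_itvl; rewrite bnd_simp ltW.
have i2 : mu.-integrable `]tau, t[ (EFin \o phi).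
  apply: integrableS iphi => //; try exact: measurable_itv.
  by apply: subset_itvr; rewrite bnd_simp ltW.
have -> : \int[mu]_(s in `]0, t[) phi s =
    \int[mu]_(s in `]0, tau[) phi s + \int[mu]_(s in `]tau, t[) phi s.
  have split := @Rintegral_itvB R phi (BRight 0) (BLeft t) tau iphi.
  rewrite (Rintegral_itv_bndo_bndc i1) -split ?bnd_simp ?ltW//.
  by rewrite addrCA subrr addr0.
(* For $s<\tau<t$ the increment $B(t)-B(s)$ is [A1] minus $\delta s^{\alpha-1}$; for $s>\tau$ it is
   $(M+\delta)(t^{\alpha-1}-s^{\alpha-1})$. *)
pose A1 := M * (t `^ (al - 1) - tau `^ (al - 1)) + de * t `^ (al - 1).
have le1 := @integral_kernel_ge al t A1 de 0 tau phi al0 (lexx _) tau0 (or_introl taut).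
have le2 := @integral_kernel_ge al t ((M + de) * t `^ (al - 1)) (M + de) tau t phi
  al0 (ltW tau0) taut.
have Mde0 : 0 <= M + de by rewrite addr_ge0.
apply: le_trans (lerD (le1 _ i1 _) (le2 _ _ i2 _)) => {le1 le2}.
(* The two primitives differ at $\tau$ by $-M\tau^{\alpha-1}t^{-1}(t-\tau)^{1-\alpha}$, which is the
   truncated term in [rho_scale]. *)
- rewrite F0 Ft /barrier E1ge ?(ltW taut)// /F /A1.
  have tauE := powRB1K al tau0.
  have tE : (t - tau) `^ (1 - al) = (t - tau) `^ (- al) * (t - tau).
    by rewrite -(powRB1K (1 - al) ttau0); congr (_ `^ _ * _); ring.
  rewrite tE -tauE. rewrite le_eqVlt; apply/orP; left; apply/eqP.
  by field; rewrite gt_eqF.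
- move=> s /andP[s0 stau]; rewrite /A1.
  have := pow_le _ _ s0 (ltW (lt_trans stau taut)).
  have := pow_le _ _ tau0 (ltW taut).
  nra.
- move=> s /andP[s0 stau]; have stt := lt_trans stau taut.
  apply: le_trans (phige s _); last by rewrite s0 stt.
  rewrite /barrier E1ge ?(ltW taut)// E1le ?(ltW stau)//.
  by rewrite le_eqVlt; apply/orP; left; apply/eqP; rewrite /A1; ring.
- by right.
- by move=> s /andP[s0 st]; rewrite ler_wpM2l// pow_le// ltW.
- move=> s /andP[taus st]; have s0 := lt_trans tau0 taus.
  apply: le_trans (phige s _); last by rewrite s0 st.
  rewrite /barrier !E1ge ?(ltW taut) ?(ltW taus)//.
  by rewrite le_eqVlt; apply/orP; left; apply/eqP; ring.
Qed.
End caputo_barrier.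

(** * Comparison principle *)

Section comparison.
Variable R : realType.
Implicit Types al s t tau M de lam G : R.
Notation mu := (@lebesgue_measure R).

Lemma continuous_barrier al tau M de s : 0 < tau -> 0 < s ->
  {for s, continuous (barrier al tau M de)}.
Proof.
move=> tau0 s0; apply: continuousD.
  apply: continuousM; first exact: cst_continuous.
  apply: (@continuous_comp _ _ _ (Num.max tau) (fun x => x `^ (al - 1))).
    by apply: continuous_max => //; exact: cst_continuous.
  by apply: continuous_powR; rewrite lt_max tau0.
apply: continuousM; first exact: cst_continuous.
exact: continuous_powR.
Qed.

(** The differential inequality stays multiplied by [y t], as the energy argument delivers it; this
    avoids dividing where [y] vanishes. At a positive maximum of $y-B$ the increments of $y$
    dominate those of $B$, and [barrier_integral_ge] then contradicts the bound on [r]. *)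
Lemma caputo_comparison al tau lam G M t0 (y r : R -> R) :
  0 < al < 1 -> 0 < tau -> 0 <= lam -> 0 < G -> 0 <= M -> 0 < t0 ->
  (forall s, 0 <= y s) ->
  (exists K, forall s, 0 < s < t0 -> y s <= K) ->
  (forall a : R, 0 < a < t0 -> {within `[a, t0], continuous y}) ->
  (forall t, 0 < t <= t0 -> exists phi : R -> R,
    [/\ mu.-integrable `]0, t[ (EFin \o phi),
        forall s, 0 < s < t ->
          y t * (al * (t - s) `^ (- al - 1) * (y t - y s)) <= phi s &
        G * (t `^ (- al) * y t ^+ 2 + \int[mu]_(s in `]0, t[) phi s)
          + lam * y t ^+ 2 <= r t * y t]) ->
  (forall t, 0 < t <= t0 ->
    r t <= M * (G * t^-1 * rho (1 - al) (tau / t) + lam * calE1 al tau t)) ->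
  y t0 <= M * calE1 al tau t0.
Proof.
move=> al01 tau0 lam0 G0 M0 t00 y0 [K yK] cy ineq rM.
have /andP[al0 al1] := al01.
suff main de : 0 < de -> y t0 <= barrier al tau M de t0.
  (* The choice $\delta=e/t_0^{\alpha-1}$ makes the extra barrier term at [t0] equal to [e]. *)
  apply/ler_addgt0Pr => e e0.
  have pt : 0 < t0 `^ (al - 1) by exact: powR_gt0.
  by have := main _ (divr_gt0 e0 pt); rewrite /barrier mulfVK ?gt_eqF.
move=> de0; rewrite leNgt; apply/negP => yt0.
pose B := barrier al tau M de; rewrite -/B in yt0.
have B0 s : 0 < s -> 0 <= M * calE1 al tau s < B s.
  move=> s0; rewrite mulr_ge0 ?powR_ge0//= ltrDl mulr_gt0 ?powR_gt0//.
pose K1 := `|K| + 1; have K10 : 0 < K1 / de by rewrite divr_gt0// /K1; have := normr_ge0 K; lra.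
(* The second entry solves $\delta s^{\alpha-1}=K_1$; below it the barrier exceeds the bound [K] of
   [y]. The first entry keeps [a < t0]. *)
pose a := Num.min (t0 / 2) ((K1 / de) `^ (al - 1)^-1).
have a0 : 0 < a by rewrite lt_min powR_gt0// andbT; lra.
have at0 : a < t0 by rewrite gt_min; apply/orP; left; lra.
have small s : 0 < s -> s <= a -> y s < B s.
  move=> s0 sa; have sK : y s <= K by apply: yK; rewrite s0 (le_lt_trans sa).
  apply: (le_lt_trans sK); have /andP[h1 _] := B0 _ s0.
  apply: (@lt_le_trans _ _ (de * s `^ (al - 1))); last by rewrite lerDr.
  rewrite mulrC -ltr_pdivrMr//; apply: (@lt_le_trans _ _ (K1 / de)).
    by rewrite ltr_pM2r ?invr_gt0// /K1; have := ler_norm K; lra.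
  have -> : K1 / de = ((K1 / de) `^ (al - 1)^-1) `^ (al - 1).
    by rewrite -powRrM mulVf ?powRr1// ?ltW//; lra.
  apply: le0_ger_powR => //; first lra.
  by apply: (le_trans sa); rewrite ge_min lexx orbT.
have cyB : {within `[a, t0], continuous (y - B)}.
  have cB : {within `[a, t0], continuous B}.
    apply: continuous_in_subspaceT => s; rewrite inE/= in_itv/= => /andP[as_ _].
    by apply: continuous_barrier => //; exact: lt_le_trans as_.
  have cya : {within `[a, t0], continuous y}.
    by apply: cy; rewrite a0 at0.
  by move=> s; apply: cvgB; [exact: cya|exact: cB].
have [t1 /[!in_itv]/= /andP[at1 t1t0] max1] := EVT_max (ltW at0) cyB.
have t10 := lt_le_trans a0 at1.
have yB1 : 0 < y t1 - B t1.
  have := max1 t0; rewrite in_itv/= lexx ltW// => /(_ isT).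
  by apply: lt_le_trans; rewrite subr_gt0.
(* The maximum over [[a, t0]] also dominates on []0, a]], where $y-B$ is negative while its value at
   [t1] is positive. *)
have max s : 0 < s -> s < t1 -> y s - B s <= y t1 - B t1.
  move=> s0 st1; have [sa|as_] := leP s a.
    by rewrite (le_trans _ (ltW yB1))// subr_le0 ltW// small.
  by apply: max1; rewrite in_itv/= (ltW as_) (le_trans (ltW st1)).
have /andP[B1 B2] := B0 _ t10.
have y1 : 0 < y t1 by lra.
have t1t : 0 < t1 <= t0 by rewrite t10.
have [phi [iphi phige hle]] := ineq _ t1t.
(* The barrier is scaled by the constant [y t1], since [phi] dominates [y t1] times the kernel
   expression. *)
have := @barrier_integral_ge R al tau t1 (y t1 * M) (y t1 * de) phi al01 tau0 t10
  (mulr_ge0 (ltW y1) M0) (mulr_ge0 (ltW y1) (ltW de0)) iphi.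
have bE s : barrier al tau (y t1 * M) (y t1 * de) s = y t1 * B s.
  by rewrite /B /barrier; ring.
rewrite !bE => intge.
have {}intge : y t1 * M * (t1^-1 * rho (1 - al) (tau / t1)) -
    t1 `^ (- al) * (y t1 * B t1) <= \int[mu]_(s in `]0, t1[) phi s.
  apply: intge => s s01; have /andP[s0 st1] := s01.
  apply: le_trans (phige s s01); rewrite bE -mulrBr mulrCA ler_wpM2l ?(ltW y1)//.
  rewrite ler_wpM2l ?mulr_ge0 ?powR_ge0 ?(ltW al0)//.
  by have := max s s0 st1; lra.
have rM1 := rM _ t1t.
have Pt : 0 < t1 `^ (- al) by exact: powR_gt0.
move: intge hle rM1 Pt.
set I := \int[mu]_(s in _) _; set w := t1^-1 * rho _ _.
rewrite -(mulrA G) -/w; set E := calE1 _ _ _ in B1 B2 *; set P := t1 `^ _.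
move=> intge hle rM1 Pt.
have h1 : G * (P * y t1 ^+ 2 + (y t1 * M * w - P * (y t1 * B t1)))
    + lam * y t1 ^+ 2 <= M * (G * w + lam * E) * y t1.
  apply: (@le_trans _ _ (r t1 * y t1)); last by rewrite ler_wpM2r ?(ltW y1).
  by apply: le_trans hle; rewrite lerD2r ler_wpM2l ?(ltW G0)// lerD2l.
(* In [h1] the terms with [w] cancel. What is left is positive because $y(t_1)>B(t_1)>ME$, a
   contradiction. *)
have h2 : y t1 * (G * (P * (y t1 - B t1)) + lam * (y t1 - M * E)) <= 0.
  by rewrite -subr_ge0 in h1; rewrite -oppr_ge0 (le_trans h1)// le_eqVlt;
    apply/orP; left; apply/eqP; ring.
have h3 : 0 < G * (P * (y t1 - B t1)) by rewrite !mulr_gt0.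
have h4 : 0 <= lam * (y t1 - M * E) by rewrite mulr_ge0//; lra.
have : 0 < y t1 * (G * (P * (y t1 - B t1)) + lam * (y t1 - M * E)).
  by rewrite mulr_gt0// ltr_wpDr.
by rewrite ltNge h2.
Qed.
End comparison.

(** * The L2 pairing *)

Section L2_theory.
Variables (R : realType) (d : nat) (Omega : set 'rV[R]_d).
Notation mu := (lebesgue_rV R d).
Implicit Types (v w g phi : 'rV[R]_d -> R) (a : R).

Let restrictE v x : (v \_ Omega) x = if x \in Omega then v x else 0.
Proof. by rewrite patchE. Qed.

Let restrictZD a v w : (a *: v + w) \_ Omega = a *: v \_ Omega + w \_ Omega.
Proof.
apply/funext => x; rewrite restrictE !fctE !restrictE.
by case: ifP => // _; rewrite scaler0 addr0.
Qed.

Let restrictM v w : (v \* w) \_ Omega = v \_ Omega \* w \_ Omega.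
Proof.
apply/funext => x; rewrite restrictE /= !restrictE.
by case: ifP => // _; rewrite mulr0.
Qed.

Lemma L2_linear a v w : L2 Omega v -> L2 Omega w -> L2 Omega (a *: v + w).
Proof.
rewrite /L2 restrictZD; have [_ +] := @Lfun_submod_closed _ _ R mu _ (lee1n 2).
exact.
Qed.

Lemma L2_0 : L2 Omega (cst 0).
Proof.
rewrite /L2 (_ : _ \_ Omega = 0).
  by have [] := @Lfun_submod_closed _ _ R mu _ (lee1n 2).
by apply/funext => x; rewrite restrictE; case: ifP.
Qed.

Lemma L2_Z a v : L2 Omega v -> L2 Omega (a *: v).
Proof. by move=> Lv; rewrite -[_ *: _]addr0; exact: (L2_linear a Lv L2_0). Qed.

Lemma L2_D v w : L2 Omega v -> L2 Omega w -> L2 Omega (v + w).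
Proof. by move=> Lv Lw; rewrite -[v]scale1r; exact: L2_linear. Qed.

Lemma L2_B v w : L2 Omega v -> L2 Omega w -> L2 Omega (v - w).
Proof. by move=> Lv Lw; rewrite -scaleN1r addrC; exact: L2_linear. Qed.

Lemma L2_integrable v w : L2 Omega v -> L2 Omega w ->
  mu.-integrable setT (EFin \o (v \* w) \_ Omega).
Proof. by move=> Lv Lw; rewrite restrictM; exact/Lfun1_integrable/Lfun2_mul_Lfun1. Qed.

Lemma dotL2E v w : dotL2 Omega v w = \int[mu]_x ((v \* w) \_ Omega) x.
Proof. by rewrite /dotL2 Rintegral_mkcond. Qed.

Lemma dotL2C v w : dotL2 Omega v w = dotL2 Omega w v.
Proof. by apply: eq_Rintegral => x _; rewrite mulrC. Qed.

Lemma dotL2_linear a v v' w : L2 Omega v -> L2 Omega v' -> L2 Omega w ->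
  dotL2 Omega (a *: v + v') w = a * dotL2 Omega v w + dotL2 Omega v' w.
Proof.
move=> Lv Lv' Lw; rewrite !dotL2E.
have i1 := L2_integrable Lv Lw; have i2 := L2_integrable Lv' Lw.
rewrite -RintegralZl// -RintegralD//; last exact: integrableZl i1.
apply: eq_Rintegral => x _; rewrite !restrictE /=; case: ifP => _.
  by rewrite !fctE mulrDl mulrA.
by rewrite mulr0 addr0.
Qed.

Lemma dotL2_Dl v v' w : L2 Omega v -> L2 Omega v' -> L2 Omega w ->
  dotL2 Omega (v + v') w = dotL2 Omega v w + dotL2 Omega v' w.
Proof. by move=> *; rewrite -[v]scale1r dotL2_linear// scale1r mul1r. Qed.

Lemma dotL2_Bl v v' w : L2 Omega v -> L2 Omega v' -> L2 Omega w ->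
  dotL2 Omega (v - v') w = dotL2 Omega v w - dotL2 Omega v' w.
Proof.
move=> Lv Lv' Lw; rewrite -scaleN1r addrC dotL2_linear//.
by rewrite mulN1r addrC.
Qed.

Lemma dotL2_0l w : dotL2 Omega (cst 0) w = 0.
Proof.
rewrite dotL2E (@eq_Rintegral _ _ _ _ _ (cst 0)); first by rewrite Rintegral_cst// mul0r.
by move=> x _; rewrite restrictE /= mul0r; case: ifP.
Qed.

Lemma dotL2_Zl a v w : L2 Omega v -> L2 Omega w ->
  dotL2 Omega (a *: v) w = a * dotL2 Omega v w.
Proof.
move=> Lv Lw; have := dotL2_linear a Lv L2_0 Lw.
by rewrite dotL2_0l !addr0.
Qed.

Lemma dotL2_ge0 v : 0 <= dotL2 Omega v v.
Proof. by apply: Rintegral_ge0 => x _; rewrite -expr2 sqr_ge0. Qed.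

Lemma normL2_ge0 v : 0 <= normL2 Omega v.
Proof. exact: sqrtr_ge0. Qed.

Lemma sqr_normL2 v : normL2 Omega v ^+ 2 = dotL2 Omega v v.
Proof. by rewrite sqr_sqrtr// dotL2_ge0. Qed.

(** Cauchy-Schwarz, from $\|v-sw\|^2\ge0$ for every real $s$. The pairing acts on functions, so
    $\|w\|=0$ does not make [w] the zero function and is treated apart. *)
Lemma dotL2_le v w : L2 Omega v -> L2 Omega w ->
  dotL2 Omega v w <= normL2 Omega v * normL2 Omega w.
Proof.
move=> Lv Lw.
pose p := dotL2 Omega v v; pose q := dotL2 Omega w w; pose c := dotL2 Omega v w.
have quad s : 0 <= p - 2 * s * c + s ^+ 2 * q.
  have Lsw := L2_Z s Lw.
  have := dotL2_ge0 (v - s *: w).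
  have Lvsw := L2_B Lv Lsw.
  rewrite dotL2_Bl// dotL2_Zl// ![dotL2 _ _ (_ - _)]dotL2C !dotL2_Bl// !dotL2_Zl//.
  rewrite (dotL2C w v) -/p -/q -/c => /le_trans; apply; rewrite le_eqVlt.
  by apply/orP; left; apply/eqP; ring.
have p0 : 0 <= p := dotL2_ge0 v.
have [c0|c0] := leP c 0.
  by rewrite (le_trans c0)// mulr_ge0// normL2_ge0.
have := dotL2_ge0 w; rewrite -/q le_eqVlt => /predU1P[q0|q0].
  (* With $q=0<c$ the quadratic is affine in $s$, and this value of $s$ makes it $-1$. *)
  have := quad ((p + 1) / (2 * c)); rewrite -q0 mulr0 addr0.
  have -> : 2 * ((p + 1) / (2 * c)) * c = p + 1 by field; rewrite gt_eqF.
  lra.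
rewrite -/c -(@ler_pXn2r _ 2) ?nnegrE ?(ltW c0) ?mulr_ge0 ?normL2_ge0//.
rewrite exprMn !sqr_normL2 -/p -/q.
(* $s=c/q$ minimises the quadratic. *)
have := quad (c / q); have -> : p - 2 * (c / q) * c + (c / q) ^+ 2 * q = p - c ^+ 2 / q.
  by field; rewrite gt_eqF.
by rewrite subr_ge0 ler_pdivrMr.
Qed.

Lemma normL2_B v w : L2 Omega v -> L2 Omega w ->
  normL2 Omega (v - w) <= normL2 Omega v + normL2 Omega w.
Proof.
move=> Lv Lw; rewrite -(@ler_pXn2r _ 2) ?nnegrE ?addr_ge0 ?normL2_ge0//.
have Lvw := L2_B Lv Lw.
have LNw : L2 Omega (- w) by rewrite -scaleN1r; exact: L2_Z.
rewrite sqr_normL2 dotL2_Bl// ![dotL2 _ _ (_ - _)]dotL2C !dotL2_Bl// (dotL2C w v).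
rewrite sqrrD !sqr_normL2.
have := dotL2_le LNw Lv.
have -> : dotL2 Omega (- w) v = - dotL2 Omega v w.
  by rewrite -scaleN1r dotL2_Zl// mulN1r dotL2C.
have -> : normL2 Omega (- w) = normL2 Omega w.
  congr Num.sqrt; apply: eq_Rintegral => x _; exact: mulrNN.
rewrite mulr2n; lra.
Qed.

Lemma normL2_sym v w : normL2 Omega (v - w) = normL2 Omega (w - v).
Proof.
congr Num.sqrt; apply: eq_Rintegral => x _.
by rewrite -[in RHS]opprB mulrNN.
Qed.

Lemma normL2_dist v w : L2 Omega v -> L2 Omega w ->
  `|normL2 Omega v - normL2 Omega w| <= normL2 Omega (v - w).
Proof.
have dist v' w' : L2 Omega v' -> L2 Omega w' ->
    normL2 Omega v' - normL2 Omega w' <= normL2 Omega (v' - w').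
  move=> Lv Lw; have := normL2_B (L2_B Lw Lv) Lw.
  rewrite (_ : w' - v' - w' = 0 - v'); last by rewrite addrAC subrr.
  by rewrite (normL2_sym 0) subr0 (normL2_sym w'); lra.
move=> Lv Lw; rewrite ler_norml; have := dist v w Lv Lw; have := dist w v Lw Lv.
rewrite (normL2_sym w); lra.
Qed.

Lemma dotL2_ae v v' w : L2 Omega v -> L2 Omega v' -> L2 Omega w ->
  ae_eq_in Omega v v' -> dotL2 Omega v w = dotL2 Omega v' w.
Proof.
move=> Lv Lv' Lw vv'; rewrite !dotL2E; congr fine.
apply: ae_eq_integral => //.
- exact: measurable_int (L2_integrable Lv Lw).
- exact: measurable_int (L2_integrable Lv' Lw).
apply: filterS vv' => x vv' _; rewrite !restrictE/=; case: ifP => // /set_mem xO.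
by rewrite vv'.
Qed.

End L2_theory.

(** * Borel sets and cubes in R^d *)

Section rV_measure.
Variables (R : realType) (n : nat).

(** The sigma-algebra is generated by the coordinates, so [U] is written as the countable union of
    the rational boxes that it contains; the other indices contribute the empty set. *)
Lemma open_measurable_rV (U : set 'rV[R]_n) : open U -> measurable U.
Proof.
move=> oU.
pose box (qk : 'rV[rat]_n * nat) : set 'rV[R]_n :=
  \bigcap_(i in [set: 'I_n]) [set x | `|x ord0 i - ratr (qk.1 ord0 i)| < qk.2.+1%:R^-1].
pose F qk := if `[< box qk `<=` U >] then box qk else set0.
have -> : U = \bigcup_qk F qk.
  apply/seteqP; split => [x Ux|x [qk _]]; last first.
    by rewrite /F; case: ifPn => // /asboolP; exact.
  have /nbhs_ballP[e /= e0 xeU] : nbhs x U by exact: open_nbhs_nbhs.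
  (* Half of [e], because two points of one box may be nearly twice its radius apart. *)
  have [k ke] : exists k : nat, k.+1%:R^-1 < e / 2.
    exists (Num.truncn (e / 2)^-1); rewrite invf_plt ?posrE ?divr_gt0//.
    exact: truncnS_gt.
  have kgt0 : 0 < k.+1%:R^-1 :> R by rewrite invr_gt0.
  have /choice[q qP] (i : 'I_n) : exists q : rat, `|x ord0 i - ratr q| < k.+1%:R^-1.
    have : x ord0 i - k.+1%:R^-1 < x ord0 i + k.+1%:R^-1.
      by rewrite ltrBlDr -addrA ltrDl addr_gt0.
    move=> /rat_in_itvoo[q]; rewrite in_itv/= => /andP[q1 q2].
    by exists q; rewrite ltr_distlC q1 q2.
  exists (\row_i q i, k) => //; rewrite /F asboolT; last first.
    move=> y yb; apply: xeU; split => // i j; rewrite (ord1 i) /ball/=.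
    have := yb j I; have := qP j; rewrite /= mxE => h1 h2.
    rewrite (_ : x ord0 j - y ord0 j =
      (x ord0 j - ratr (q j)) - (y ord0 j - ratr (q j))); last by ring.
    apply: (le_lt_trans (ler_normB _ _)); apply: (lt_trans (ltrD h1 h2)).
    by rewrite [ltRHS]splitr ltrD.
  by move=> i _ /=; rewrite mxE; exact: qP.
apply: countable_bigcupT_measurable; first exact: countableP.
move=> qk; rewrite /F; case: ifP => // _.
apply: fin_bigcap_measurable; first exact: finite_finset.
move=> i _; rewrite -[X in measurable X]setTI.
have mi : measurable_fun setT
    (fun x : 'rV[R]_n => `|(x ord0 i : measurableTypeR R) - ratr (qk.1 ord0 i)|).
  apply: measurableT_comp; first exact: normr_measurable.
  by apply: measurable_funB => //; exact: measurable_coord.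
rewrite [X in _ `&` X](_ : _ = (fun x : 'rV[R]_n =>
    `|(x ord0 i : measurableTypeR R) - ratr (qk.1 ord0 i)|) @^-1` `]-oo, qk.2.+1%:R^-1[).
  by apply: mi => //; exact: measurable_itv.
by apply/seteqP; split => x /=; rewrite in_itv.
Qed.

Lemma continuous_measurable_rV (g : 'rV[R]_n -> R) :
  continuous g -> measurable_fun setT g.
Proof.
move=> cg; apply: (measurability (@RGenOInfty.G R)).
  exact: RGenOInfty.measurableE.
move=> _ [_ [a ->] <-]; rewrite setTI; apply: open_measurable_rV.
by apply: open_comp => [x _|]; [exact: cg|exact: interval_open].
Qed.

End rV_measure.

Section rV_finite.
Variables (R : realType).

Definition cube n (M : R) : set 'rV[R]_n :=
  \bigcap_(i in [set: 'I_n]) [set x | `|x ord0 i| <= M].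

Lemma measurable_cube n M : measurable (@cube n M).
Proof.
apply: fin_bigcap_measurable; first exact: finite_finset.
move=> i _; rewrite -[X in measurable X]setTI.
have mi : measurable_fun setT (fun x : 'rV[R]_n => `|x ord0 i : measurableTypeR R|).
  by apply: measurableT_comp; [exact: normr_measurable|exact: measurable_coord].
rewrite [X in _ `&` X](_ : _ = (fun x : 'rV[R]_n =>
    `|x ord0 i : measurableTypeR R|) @^-1` `]-oo, M]).
  by apply: mi => //; exact: measurable_itv.
by apply/seteqP; split => x /=; rewrite in_itv.
Qed.

(** Induction on the dimension: through [rV_cons] the cube becomes the product of an interval and
    the cube of one dimension less. *)
Lemma lebesgue_cube_lty n M : (lebesgue_rV R n (@cube n M) < +oo)%E.
Proof.
elim: n => [|n IH].
  rewrite /= diracE; exact: ltry.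
rewrite /= /lebesgue_rV_step /pushforward.
have -> : @rV_cons R n @^-1` cube M = [set` `[-M, M] ] `*` @cube n M.
  apply/seteqP; split => [[a v]|[a v]] /=.
    move=> h; split => /=.
      have := h ord0 I; rewrite /= /rV_cons mxE unlift_none/=.
      by rewrite in_itv/= ler_norml.
    by move=> i _ /=; have := h (lift ord0 i) I; rewrite /= /rV_cons mxE liftK.
  rewrite in_itv/= => -[aM vM] i _ /=; rewrite /rV_cons mxE.
  by case: unliftP => [j _|_] /=; [exact: vM|rewrite ler_norml].
rewrite product_measure1E//; last exact: measurable_cube.
apply: lte_mul_pinfty => //.
have := @lebesgue_measure_itv R `[- M, M]; rewrite /= => ->; by case: ifP.
Qed.

End rV_finite.

(** * Test functions and H^1_0 *)

Section test_functions.
Variables (R : realType) (d : nat) (Omega : set 'rV[R]_d).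
Notation mu := (lebesgue_rV R d).
Implicit Types (v w g phi psi : 'rV[R]_d -> R) (K : set 'rV[R]_d).

Lemma ler_coord_norm (x : 'rV[R]_d) i : `|x ord0 i| <= `|x|.
Proof.
rewrite [leRHS]mx_normrE.
exact: (le_bigmax _ (fun ij : 'I_1 * 'I_d => `|x ij.1 ij.2|) (ord0, i)).
Qed.

Lemma compact_sub_cube K : compact K -> exists M, K `<=` @cube R d M.
Proof.
move=> /compact_bounded[M [_ KM]]; exists (M + 1) => x Kx i _ /=.
by apply: (le_trans (ler_coord_norm x i)); apply: KM => //; rewrite ltrDl.
Qed.

(** Since [g] vanishes off [K], its restriction to [Omega] is [g] itself, measurable by continuity.
    It is bounded and lives on a cube of finite measure. *)
Lemma continuous_compact_support_L2 g K : continuous g -> compact K ->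
  K `<=` Omega -> (forall x, ~ K x -> g x = 0) -> L2 Omega g.
Proof.
move=> cg cK KO gK.
have gO : g \_ Omega = g.
  apply/funext => x; rewrite patchE; case: ifPn => // /negP xO.
  by rewrite gK// => Kx; apply: xO; rewrite inE; exact: KO.
have mg := continuous_measurable_rV cg.
have [M KM] := compact_sub_cube cK.
have mM : measurable (@cube R d M) by exact: measurable_cube.
have [C gC] : exists C, forall x, `|g x| <= C.
  have /compact_bounded[C [_ gC]] : compact (g @` K).
    by apply: continuous_compact => //; exact: continuous_subspaceT.
  exists (`|C| + 1) => x; have [Kx|Kx] := pselect (K x).
    apply: gC; last by exists x.
    by rewrite (le_lt_trans (ler_norm _))// ltrDl.
  by rewrite gK// normr0 addr_ge0.
rewrite /L2 gO inE; apply/andP; split; rewrite inE//=.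
rewrite /finite_norm unlock /Lnorm; apply: poweR_lty.
have -> : (fun x => `|(EFin \o g) x| `^ 2)%E =
    ((fun x => (`|g x| `^ 2)%:E) \_ (@cube R d M)).
  apply/funext => x /=; rewrite patchE; case: ifPn => // /negP xM.
  rewrite gK ?normr0 ?powR0// => Kx; apply: xM; rewrite inE; exact: KM.
rewrite -integral_mkcond; apply: (@le_lt_trans _ _ (\int[mu]_(x in cube M) cst (C `^ 2)%:E x)%E).
  apply: ge0_le_integral => //.
  - apply/measurable_EFinP/measurable_funTS.
    apply: (@measurableT_comp _ _ _ _ _ _ (fun x : R => x `^ 2)) => //.
    exact: measurableT_comp.
  - move=> x _; rewrite /= lee_fin.
    by apply: ge0_ler_powR; rewrite ?nnegrE// (le_trans _ (gC x)).
by rewrite integral_cst//; apply: lte_mul_pinfty; rewrite ?lee_fin ?powR_ge0//;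
  exact: lebesgue_cube_lty.
Qed.

Let supp phi := closure [set x | phi x != 0].

Lemma supp_eq0 phi x : ~ supp phi x -> phi x = 0.
Proof.
by move=> xs; apply: contrapT => /eqP phix; apply: xs; exact: subset_closure.
Qed.

Lemma test_fun_L2 phi : test_fun Omega phi -> L2 Omega phi.
Proof.
move=> [cphi _ cK KO]; apply: (continuous_compact_support_L2 (cphi [::]) cK KO).
exact: supp_eq0.
Qed.

Lemma test_fun_partial_L2 phi i : test_fun Omega phi -> L2 Omega (partial i phi).
Proof.
move=> [cphi _ cK KO].
apply: (continuous_compact_support_L2 (cphi [:: i]) cK KO) => x xs.
rewrite /= /partial (@near_eq_derive _ _ _ _ (cst 0)) ?derive_cst//.
have : open (~` supp phi) by apply: closed_openC; exact: closed_closure.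
move=> oS; have := open_nbhs_nbhs (conj oS xs).
by apply: filterS => y; exact: supp_eq0.
Qed.

Lemma test_fun_B phi psi :
  test_fun Omega phi -> test_fun Omega psi -> test_fun Omega (phi - psi).
Proof.
move=> [c1 d1 k1 s1] [c2 d2 k2 s2].
have foldrB (s : seq 'I_d) : foldr (@partial R d) (phi - psi) s =
      foldr (@partial R d) phi s - foldr (@partial R d) psi s.
  elim: s => //= i s ->; apply/funext => x.
  by rewrite /partial deriveB.
have suppB : supp (phi - psi) `<=` supp phi `|` supp psi.
  rewrite -closureU; apply: closure_subset => x /=.
  have [|] := eqVneq (phi x) 0; last by left.
  by rewrite !fctE => ->; rewrite sub0r oppr_eq0; right.
split.
- by move=> s x; rewrite foldrB; apply: continuousB; [exact: (c1 s)|exact: (c2 s)].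
- by move=> s i x; rewrite foldrB; apply: derivableB.
- apply: subclosed_compact suppB; first exact: closed_closure.
  exact: compactU.
- by apply: (subset_trans suppB) => x [/s1|/s2].
Qed.

Lemma partial_B i phi psi : test_fun Omega phi -> test_fun Omega psi ->
  partial i (phi - psi) = partial i phi - partial i psi.
Proof.
move=> [_ d1 _ _] [_ d2 _ _]; apply/funext => x.
by rewrite /partial deriveB//; [exact: (d1 [::])|exact: (d2 [::])].
Qed.

Lemma H1_B v gv w gw : H1 Omega v gv -> H1 Omega w gw ->
  H1 Omega (v - w) (gv - gw).
Proof.
move=> [Lv Hv] [Lw Hw]; split; first exact: L2_B.
move=> i; have [Lgv pv] := Hv i; have [Lgw pw] := Hw i.
split; first exact: L2_B.
move=> phi tphi; rewrite !dotL2_Bl//; try exact: test_fun_L2.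
  by rewrite pv// pw// opprD opprK.
exact: test_fun_partial_L2.
Qed.

(** Differences of the approximating test functions approximate the difference. This allows the
    error itself as a test function in the residual identities. *)
Lemma H10_B v gv w gw : H10 Omega v gv -> H10 Omega w gw ->
  H10 Omega (v - w) (gv - gw).
Proof.
move=> [Hv [phi [tphi phiv phigv]]] [Hw [psi [tpsi psiw psigw]]].
have [Lv Lgv] := Hv; have [Lw Lgw] := Hw.
split; first exact: H1_B.
have cvgB0 (a b : nat -> 'rV[R]_d -> R) (v' w' : 'rV[R]_d -> R) :
    L2 Omega v' -> L2 Omega w' ->
    (forall n, L2 Omega (a n)) -> (forall n, L2 Omega (b n)) ->
    normL2 Omega (a n - v') @[n --> \oo] --> 0 ->
    normL2 Omega (b n - w') @[n --> \oo] --> 0 ->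
    normL2 Omega (a n - b n - (v' - w')) @[n --> \oo] --> 0.
  move=> Lv' Lw' La Lb cav cbw.
  have cs : normL2 Omega (a n - v') + normL2 Omega (b n - w') @[n --> \oo] --> (0 : R).
    by rewrite -(addr0 0); apply: cvgD.
  apply: (squeeze_cvgr _ (cvg_cst (0 : R)) cs); apply: nearW => n.
  rewrite normL2_ge0/=.
  have -> : a n - b n - (v' - w') = a n - v' - (b n - w').
    by rewrite !opprB addrACA [in RHS]addrACA; congr (_ + _); rewrite addrC.
  by apply: normL2_B; apply: L2_B.
exists (fun n => phi n - psi n); split.
- by move=> n; exact: test_fun_B.
- by apply: cvgB0 => // n; exact: test_fun_L2.
- move=> i; under eq_fun do rewrite (partial_B i (tphi _) (tpsi _)).
  apply: cvgB0 => //; [by have [] := Lgv i|by have [] := Lgw i| |];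
    by move=> n; exact: test_fun_partial_L2.
Qed.

End test_functions.

(** * The bilinear form *)

Section pairing.
Variables (R : realType) (d : nat) (Omega : set 'rV[R]_d).
Notation mu := (lebesgue_rV R d).
Implicit Types (v w a g h : 'rV[R]_d -> R) (gv gw : 'I_d -> 'rV[R]_d -> R).

Let restrictE v x : (v \_ Omega) x = if x \in Omega then v x else 0.
Proof. by rewrite patchE. Qed.

Let integ (F : 'rV[R]_d -> R) := mu.-integrable setT (EFin \o F \_ Omega).

Let integD F G : integ F -> integ G -> integ (fun x => F x + G x).
Proof.
move=> iF iG; have := integrableD measurableT iF iG.
apply: eq_integrable => // x _ /=; rewrite -EFinD !restrictE.
by case: ifP => // _; rewrite addr0.
Qed.

Let integ_sum (F : 'I_d -> 'rV[R]_d -> R) :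
  (forall i, integ (F i)) -> integ (fun x => \sum_(i < d) F i x).
Proof.
move=> iF.
have := @integrable_sum _ _ _ mu setT measurableT _ (index_enum 'I_d) xpredT
  (fun i => EFin \o F i \_ Omega) (fun i _ => iF i).
apply: eq_integrable => // x _ /=; rewrite sumEFin restrictE; congr EFin.
have [xO|xO] := boolP (x \in Omega).
  by apply: eq_bigr => i _; rewrite restrictE xO.
by rewrite big1// => i _; rewrite restrictE (negbTE xO).
Qed.

Lemma Linfty_ae_bounded a : Linfty Omega a ->
  measurable_fun setT (a \_ Omega) /\
  exists C, {ae mu, forall x, `|(a \_ Omega) x| <= C}.
Proof.
rewrite /Linfty inE => /andP[]; rewrite !inE/= => ma.
rewrite /finite_norm unlock /Lnorm => H; split => //; move: H.
case: ifPn => [_ Soo|mu0 _].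
  have := ess_sup_ge mu (abse \o (EFin \o a \_ Omega)).
  set S := ess_sup _ _ in Soo *; move=> aS; exists (fine S).
  apply: filterS aS => x; case: S Soo => [r _|//|_] /=; first by rewrite lee_fin.
  by [].
(* Here the whole space has measure zero, so it can serve as the exceptional set. *)
exists 0, setT; split => //; apply/eqP; rewrite eq_le measure_ge0 andbT.
by rewrite leNgt.
Qed.

(** Every term of the bilinear form is of this kind. Its integrability is what justifies linearity
    of the integral in [pairing_Bl]. *)
Let integ_Linfty a g h : Linfty Omega a -> L2 Omega g -> L2 Omega h ->
  integ (fun x => a x * g x * h x).
Proof.
move=> /Linfty_ae_bounded[ma [C aC]] Lg Lh.
have /integrableP[mgh igh] := L2_integrable Lg Lh.
have E : EFin \o (fun x => a x * g x * h x) \_ Omega =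
    EFin \o (a \_ Omega \* (g \* h) \_ Omega).
  apply/funext => x /=; rewrite !restrictE; case: ifP => _; last by rewrite mulr0.
  by rewrite mulrA.
rewrite /integ E; apply/integrableP.
have mm : measurable_fun setT (a \_ Omega \* (g \* h) \_ Omega).
  by apply: measurable_funM => //; exact/measurable_EFinP.
split; first exact/measurable_EFinP.
apply: (@le_lt_trans _ _ (\int[mu]_x (`|C|%:E * `|((g \* h) \_ Omega) x|%:E))%E).
  apply: ae_ge0_le_integral => //.
  - by apply: measurableT_comp => //; exact/measurable_EFinP.
  - apply: emeasurable_funM => //.
    by apply/measurable_EFinP; apply: measurableT_comp => //; exact/measurable_EFinP.
  apply: filterS aC => x aC _; rewrite /= lee_fin normrM ler_wpM2r//.
  by rewrite (le_trans aC)// ler_norm.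
rewrite ge0_integralZl//; last first.
  by apply/measurable_EFinP; apply: measurableT_comp => //; exact/measurable_EFinP.
by rewrite lte_mul_pinfty.
Qed.

Variable L : diff_op R d.
Hypothesis La : forall i j, Linfty Omega (op_a L i j).
Hypothesis Lb : forall i, Linfty Omega (op_b L i).
Hypothesis Lc : forall i, Linfty Omega (op_c L i).
Hypothesis Lc0 : Linfty Omega (op_c0 L).

Let J v gv w gw x : R :=
    \sum_(i < d) (\sum_(j < d) op_a L i j x * gv j x + op_b L i x * v x) * gw i x
     + (\sum_(j < d) op_c L j x * gv j x + op_c0 L x * v x) * w x.

Let integJ v gv w gw : L2 Omega v -> (forall i, L2 Omega (gv i)) ->
  L2 Omega w -> (forall i, L2 Omega (gw i)) -> integ (J v gv w gw).
Proof.
move=> Lv Lgv Lw Lgw.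
have -> : J v gv w gw = fun x =>
  \sum_(i < d) (\sum_(j < d) op_a L i j x * gv j x * gw i x + op_b L i x * v x * gw i x)
  + (\sum_(j < d) op_c L j x * gv j x * w x + op_c0 L x * v x * w x).
  apply/funext => x; rewrite /J; congr (_ + _); last by rewrite mulrDl mulr_suml.
  by apply: eq_bigr => i _; rewrite mulrDl mulr_suml.
apply: integD.
  apply: integ_sum => i; apply: integD; last exact: integ_Linfty.
  by apply: integ_sum => j; exact: integ_Linfty.
apply: integD; last exact: integ_Linfty.
by apply: integ_sum => j; exact: integ_Linfty.
Qed.

Lemma pairing_Bl v gv v' gv' w gw :
  L2 Omega v -> (forall i, L2 Omega (gv i)) ->
  L2 Omega v' -> (forall i, L2 Omega (gv' i)) ->
  L2 Omega w -> (forall i, L2 Omega (gw i)) ->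
  pairing Omega L (v - v') (gv - gv') w gw =
  pairing Omega L v gv w gw - pairing Omega L v' gv' w gw.
Proof.
move=> Lv Lgv Lv' Lgv' Lw Lgw; rewrite /pairing -!/(J _ _ _ _ _).
rewrite !(Rintegral_mkcond _ Omega) -RintegralB//; last 2 first.
- exact: integJ.
- exact: integJ.
apply: eq_Rintegral => x _; rewrite !restrictE; case: ifP => _; last by rewrite subrr.
rewrite /J opprD addrACA -mulrBl -sumrB; congr (_ + _ * _).
  apply: eq_bigr => i _; rewrite -mulrBl opprD addrACA -sumrB !fctE -mulrBr.
  by congr ((_ + _) * _); apply: eq_bigr => j _; rewrite !fctE mulrBr.
rewrite opprD addrACA -sumrB !fctE -mulrBr.
by congr (_ + _); apply: eq_bigr => j _; rewrite !fctE mulrBr.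
Qed.

End pairing.

(** * Energy inequality for the error *)

Section error_bound.
Variables (R : realType) (d : nat) (Omega : set 'rV[R]_d).
Notation leb := (@lebesgue_measure R).
Implicit Types (al lam tau s t T : R).

(** Pairing with a fixed [w] turns the two weak $L_2(\Omega)$-valued integrals into scalar ones,
    which can be subtracted. The initial values agree almost everywhere and cancel, hence no term at
    time 0. *)
Lemma dotL2_caputo_B al t v1 v2 D1 D2 w :
  0 < t -> (forall s, 0 <= s <= t -> L2 Omega (v1 s)) ->
  (forall s, 0 <= s <= t -> L2 Omega (v2 s)) ->
  L2 Omega w -> ae_eq_in Omega (v1 0) (v2 0) ->
  is_caputo Omega al v1 t D1 -> is_caputo Omega al v2 t D2 ->
  let phi s := al * (t - s) `^ (- al - 1) *
    (dotL2 Omega (v1 t - v2 t) w - dotL2 Omega (v1 s - v2 s) w) in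
  leb.-integrable `]0, t[ (EFin \o phi) /\
  dotL2 Omega D1 w - dotL2 Omega D2 w = (Gamma (1 - al))^-1 *
    (t `^ (- al) * dotL2 Omega (v1 t - v2 t) w + \int[leb]_(s in `]0, t[) phi s).
Proof.
move=> t0 L1 L2v Lw v0 [I1 [LI1 /(_ w Lw)[i1 e1]] ->] [I2 [LI2 /(_ w Lw)[i2 e2]] ->] phi.
have L1t : L2 Omega (v1 t) by apply: L1; rewrite (ltW t0) lexx.
have L2t : L2 Omega (v2 t) by apply: L2v; rewrite (ltW t0) lexx.
have L10 : L2 Omega (v1 0) by apply: L1; rewrite lexx (ltW t0).
have L20 : L2 Omega (v2 0) by apply: L2v; rewrite lexx (ltW t0).
have phiE s : s \in [set` `]0, t[ ] -> phi s =
    dotL2 Omega ((al * (t - s) `^ (- al - 1)) *: (v1 t - v1 s)) w -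
    dotL2 Omega ((al * (t - s) `^ (- al - 1)) *: (v2 t - v2 s)) w.
  rewrite inE/= in_itv/= => /andP[s0 st].
  have L1s : L2 Omega (v1 s) by apply: L1; rewrite (ltW s0) (ltW st).
  have L2s : L2 Omega (v2 s) by apply: L2v; rewrite (ltW s0) (ltW st).
  rewrite /phi !dotL2_Zl//; [|exact: L2_B..].
  by rewrite !dotL2_Bl//; ring.
split.
  have /(_ (measurable_itv _)) := integrableB _ i1 i2.
  by apply: eq_integrable; [exact: measurable_itv|move=> s /phiE sE /=; rewrite sE].
have -> : \int[leb]_(s in `]0, t[) phi s = dotL2 Omega I1 w - dotL2 Omega I2 w.
  rewrite e1 e2 -RintegralB//.
  by apply: eq_Rintegral => s /phiE.
rewrite !dotL2_Zl//; [|by apply: L2_D => //; apply: L2_Z; apply: L2_B..].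
rewrite (dotL2_Bl L1t L2t Lw) !dotL2_Dl//; try by apply: L2_Z; apply: L2_B.
rewrite !dotL2_Zl//; try exact: L2_B.
rewrite !dotL2_Bl// (dotL2_ae L10 L20 Lw v0); ring.
Qed.

(** Both identities are tested with $e(t)$ and subtracted, so $f$ cancels. Coercivity and
    Cauchy-Schwarz give the last bound; the kernel bound is $\langle e(t)-e(s),e(t)\rangle\ge
    y(t)(y(t)-y(s))$. *)
Lemma energy_inequality al lam T (L : diff_op R d) (f : R -> 'rV[R]_d -> R)
    (u0 : 'rV[R]_d -> R) (u uh : R -> 'rV[R]_d -> R) (r : 'rV[R]_d -> R) t :
  0 < al < 1 -> elliptic Omega L ->
  (forall v gv, H10 Omega v gv ->
     lam * normL2 Omega v ^+ 2 <= pairing Omega L v gv v gv) ->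
  admissible Omega T u -> ae_eq_in Omega (u 0) u0 ->
  admissible Omega T uh -> ae_eq_in Omega (uh 0) u0 ->
  0 < t <= T -> L2 Omega r ->
  is_residual Omega L al f u t (cst 0) -> is_residual Omega L al f uh t r ->
  let y s := normL2 Omega (uh s - u s) in
  exists phi : R -> R,
    [/\ leb.-integrable `]0, t[ (EFin \o phi),
        forall s, 0 < s < t ->
          y t * (al * (t - s) `^ (- al - 1) * (y t - y s)) <= phi s &
        (Gamma (1 - al))^-1 * (t `^ (- al) * y t ^+ 2 + \int[leb]_(s in `]0, t[) phi s)
          + lam * y t ^+ 2 <= normL2 Omega r * y t].
Proof.
move=> /andP[al0 al1] [[La Lb Lc Lc0] _] coer [Lu _ _] uu0 [Luh _ _] uhu0 /andP[t0 tT] Lr.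
move=> [D [gv [capu Hu eu]]] [Dh [gvh [capuh Huh euh]]] y.
have inT s : 0 <= s <= t -> 0 <= s <= T.
  by move=> /andP[-> st]; rewrite (le_trans st).
have ttT : 0 <= t <= T by rewrite tT (ltW t0).
have Le : L2 Omega (uh t - u t) by apply: L2_B; [exact: Luh|exact: Lu].
have He := H10_B Huh Hu.
have ae0 : ae_eq_in Omega (uh 0) (u 0).
  by apply: filterS2 uhu0 uu0 => x h1 h2 xO; rewrite h1// h2.
have [iphi dotD] := dotL2_caputo_B t0 (fun s st => Luh s (inT s st))
  (fun s st => Lu s (inT s st)) Le ae0 capuh capu.
have [[_ Lgu] _] := Hu; have [[_ Lguh] _] := Huh.
have pB := @pairing_Bl R d Omega L La Lb Lc Lc0 (uh t) gvh (u t) gv (uh t - u t)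
  (gvh - gv) (Luh t ttT) (fun i => (Lguh i).1) (Lu t ttT) (fun i => (Lgu i).1)
  Le (fun i => L2_B (Lguh i).1 (Lgu i).1).
have := dotL2_le Lr Le; rewrite (euh _ _ He).
have := eu _ _ He; rewrite dotL2_0l.
have := coer _ _ He; rewrite pB.
set P1 := pairing _ _ _ _ _ _; set P2 := pairing _ _ _ _ _ _ => c1 c2 c3.
(* The witness is the integrand of [dotL2_caputo_B] for [w] equal to $e(t)$. *)
eexists; split; first exact: iphi.
- move=> s /andP[s0 st] /=; rewrite mulrCA ler_wpM2l ?mulr_ge0 ?powR_ge0 ?(ltW al0)//.
  have Les : L2 Omega (uh s - u s).
    by apply: L2_B; [apply: Luh|apply: Lu]; rewrite (ltW s0) (le_trans (ltW st)).
  rewrite -sqr_normL2 -/(y t) mulrBr -expr2 lerD2l lerN2 mulrC.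
  exact: dotL2_le.
- move: dotD; rewrite -sqr_normL2 -/(y t) => <-; rewrite -/(y t) in c1 c3.
  lra.
Qed.

(** A finite supremum is itself an admissible [M]. An infinite one makes the right side $+\infty$
    since [c] is positive, and [g t] rules out $-\infty$. *)
Lemma sup_upto_le (g : R -> R) c Y t : 0 < t -> 0 < c -> 0 <= g t ->
  (forall M, 0 <= M -> (forall s, 0 < s <= t -> g s <= M) -> Y <= c * M) ->
  (Y%:E <= c%:E * sup_upto t g)%E.
Proof.
move=> t0 c0 gt0 H.
have ub s : 0 < s <= t -> ((g s)%:E <= sup_upto t g)%E.
  by move=> st; apply: ereal_sup_ubound; exists s => //=; rewrite in_itv.
have gS : ((g t)%:E <= sup_upto t g)%E by apply: ub; rewrite t0 lexx.
move: ub gS; case: (sup_upto t g) => [M| |] ub gS.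
- rewrite -EFinM lee_fin; apply: H => [|s /ub]; last by rewrite lee_fin.
  by rewrite lee_fin in gS; exact: le_trans gS.
- by rewrite gt0_muley ?lte_fin// leey.
- by [].
Qed.

Lemma lipschitz_within_continuous (y : R -> R) a b K :
  (forall s t, a <= s <= b -> a <= t <= b -> `|y s - y t| <= K * `|s - t|) ->
  {within `[a, b], continuous y}.
Proof.
move=> yK; apply/subspace_continuousP => x; rewrite /= in_itv/= => xab.
apply/cvgrPdist_le => e e0; rewrite near_withinE.
have K0 : 0 < `|K| + 1 by rewrite ltr_wpDl.
apply/nbhs_ballP; exists (e / (`|K| + 1)); first exact: divr_gt0.
move=> z xz /=; rewrite in_itv/= => zab; apply: (le_trans (yK _ _ xab zab)).
apply: (@le_trans _ _ ((`|K| + 1) * `|x - z|)).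
  by rewrite ler_wpM2r// (le_trans (ler_norm _))// lerDl.
by rewrite -ler_pdivlMl// mulrC; exact: ltW.
Qed.

End error_bound.

(** * Positivity of the weights, and the case $\tau=t$ *)

Section scalar_weights.
Variable R : realType.
Implicit Types al lam tau s t : R.

Lemma calR0_gt0 al lam t : 0 < al < 1 -> 0 <= lam -> 0 < t -> 0 < calR0 al lam t.
Proof.
move=> al01 lam0 t0; rewrite ltr_wpDr// mulr_gt0 ?powR_gt0// invr_gt0 Gamma_gt0//.
by apply/andP; split; lra.
Qed.

Lemma calR1_gt0 al lam tau t :
  0 < al < 1 -> 0 <= lam -> 0 < tau -> 0 < t -> 0 < calR1 al lam tau t.
Proof.
move=> al01 lam0 tau0 t0; rewrite ltr_wpDr ?mulr_ge0 ?powR_ge0//.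
have al01' : 0 < 1 - al < 1 by apply/andP; split; lra.
have G0 : 0 < Gamma (1 - al) by apply: Gamma_gt0; apply/andP; split; lra.
by apply: mulr_gt0; [rewrite divr_gt0 ?invr_gt0|apply: rho_gt0 => //; exact: divr_gt0].
Qed.

(** Up to time $\tau=t$ the truncated power in $\rho$ vanishes and $\mathcal{E}_1$ is the constant
    $t^{\alpha-1}$. *)
Lemma calR1_late al lam t s : 0 < al < 1 -> 0 < s <= t ->
  calR1 al lam t s = t `^ (al - 1) * calR0 al lam s.
Proof.
move=> al01 /andP[s0 st]; have t0 := lt_le_trans s0 st.
rewrite /calR1 -mulrA rho_scale// /calE1.
have -> : Num.max 0 (s - t) = 0 by apply/max_idPl; rewrite subr_le0.
have -> : Num.max t s = t by apply/max_idPl.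
rewrite powR0 ?subr_eq0; last by rewrite gt_eqF//; case/andP: al01.
by rewrite /calR0; ring.
Qed.

End scalar_weights.

(** * The error bounds from the comparison principle *)

Theorem corollary2p4 (R : realType) (d : nat) (alpha T lambda tau : R)
  (Omega : set 'rV[R]_d) (L : diff_op R d)
  (f : R -> 'rV[R]_d -> R) (u0 : 'rV[R]_d -> R)
  (u uh Rh : R -> 'rV[R]_d -> R) :
  (1 <= d <= 3)%N ->
  0 < alpha < 1 -> 0 < T -> 0 <= lambda -> 0 < tau ->
  bounded_lipschitz_domain Omega ->
  elliptic Omega L ->
  (forall v gv, H10 Omega v gv ->
     lambda * normL2 Omega v ^+ 2 <= pairing Omega L v gv v gv) ->
  L2 Omega u0 ->
  (forall t, 0 < t <= T -> forall w gw, H10 Omega w gw ->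
     (lebesgue_rV R d).-integrable Omega (fun x => (f t x * w x)%:E)) ->
  is_unique_solution Omega L alpha T f u0 u ->
  admissible Omega T uh ->
  ae_eq_in Omega (uh 0) u0 ->
  (forall t, 0 < t <= T ->
     L2 Omega (Rh t) /\ is_residual Omega L alpha f uh t (Rh t)) ->
  (forall s, 0 < s ->
     s `^ (- (1 - alpha)) * Num.min ((1 - alpha) * s) 1
       <= rho (1 - alpha) s) /\
  (forall t, 0 < t <= T ->
     [/\ ((normL2 Omega (uh t - u t)%R)%:E <=
            sup_upto t (fun s => (normL2 Omega (Rh s) / calR0 alpha lambda s)%R))%E,
         ((normL2 Omega (uh t - u t)%R)%:E <=
            (t `^ (alpha - 1))%R%:E *
            sup_upto t
              (fun s => (normL2 Omega (Rh s) / calR1 alpha lambda tau s)%R))%E &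
         ((normL2 Omega (uh t - u t)%R)%:E <=
            (calE1 alpha tau t)%:E *
            sup_upto t
              (fun s => (normL2 Omega (Rh s) / calR1 alpha lambda tau s)%R))%E]).
Proof.
move=> _ al01 T0 lam0 tau0 _ ell coer _ _ [[adu uu0 resu] _] aduh uhu0 resuh.
have /andP[al0 al1] := al01.
split; first by move=> s s0; apply: rho_ge => //; apply/andP; split; lra.
pose y s := normL2 Omega (uh s - u s).
(* The parameter is left free because the first error bound uses it with [tau' = t]. *)
have bound tau' t M : 0 < tau' -> 0 < t <= T -> 0 <= M ->
    (forall s, 0 < s <= t -> normL2 Omega (Rh s) <= M * calR1 alpha lambda tau' s) ->
    y t <= M * calE1 alpha tau' t.
  move=> tau'0 /andP[t0 tT] M0 RM.
  have [Lu WLu _] := adu; have [Luh WLuh _] := aduh.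
  have Ls s : 0 <= s <= t -> L2 Omega (u s) /\ L2 Omega (uh s).
    by move=> /andP[s0 st]; split; [apply: Lu|apply: Luh]; rewrite s0 (le_trans st).
  apply: (@caputo_comparison R alpha tau' lambda (Gamma (1 - alpha))^-1 M t y
    (fun s => normL2 Omega (Rh s))) => //.
  - by rewrite invr_gt0 Gamma_gt0//; apply/andP; split; lra.
  - by move=> s; exact: normL2_ge0.
  (* Admissibility is stated for a pair of times; [t / 2] is an arbitrary left end, and only the
     uniform bound on []0, t[] is extracted. *)
  - have t2 : 0 < t / 2 by rewrite divr_gt0.
    have t2t : t / 2 < t by rewrite ltr_pdivrMr// ltr_pMr// ltr1n.
    have [[Ku hu] _] := WLu _ _ t2 t2t tT; have [[Kuh huh] _] := WLuh _ _ t2 t2t tT.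
    exists (Kuh + Ku) => s st; have /andP[s0 st'] := st.
    have [|Lus Luhs] := Ls s; first by rewrite !ltW.
    apply: (le_trans (normL2_B Luhs Lus)).
    by apply: lerD; [exact: huh|exact: hu].
  - move=> a /andP[a0 at_].
    have [_ [Ku hu]] := WLu _ _ a0 at_ tT; have [_ [Kuh huh]] := WLuh _ _ a0 at_ tT.
    apply: (@lipschitz_within_continuous _ _ _ _ (Kuh + Ku)) => s1 s2 s1t s2t.
    have Ls' s : a <= s <= t -> L2 Omega (u s) /\ L2 Omega (uh s).
      by move=> /andP[as_ st]; apply: Ls; rewrite st (le_trans (ltW a0)).
    have [Lu1 Luh1] := Ls' _ s1t; have [Lu2 Luh2] := Ls' _ s2t.
    apply: (le_trans (normL2_dist (L2_B Luh1 Lu1) (L2_B Luh2 Lu2))).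
    have -> : uh s1 - u s1 - (uh s2 - u s2) = uh s1 - uh s2 - (u s1 - u s2).
      by rewrite !opprB addrACA [in RHS]addrACA; congr (_ + _); rewrite addrC.
    apply: (le_trans (normL2_B (L2_B Luh1 Luh2) (L2_B Lu1 Lu2))).
    by rewrite mulrDl; apply: lerD; [exact: huh|exact: hu].
  - move=> s /andP[s0 st]; have sT : 0 < s <= T by rewrite s0 (le_trans st).
    have [LRs ress] := resuh _ sT.
    exact: energy_inequality al01 ell coer adu uu0 aduh uhu0 sT LRs (resu _ sT) ress.
have bound1 tau' t : 0 < tau' -> 0 < t <= T ->
    ((y t)%:E <= (calE1 alpha tau' t)%:E * sup_upto t
       (fun s => (normL2 Omega (Rh s) / calR1 alpha lambda tau' s)%R))%E.
  move=> tau'0 tT; have /andP[t0 _] := tT.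
  apply: sup_upto_le => //.
  - by rewrite powR_gt0// lt_max tau'0.
  - by rewrite divr_ge0 ?normL2_ge0// ltW// calR1_gt0.
  move=> M M0 RM; rewrite mulrC; apply: bound => // s st; have /andP[s0 _] := st.
  by have := RM s st; rewrite ler_pdivrMr// calR1_gt0.
move=> t tT; have /andP[t0 _] := tT; split; last exact: bound1.
- rewrite -[leRHS]mul1e; apply: sup_upto_le => //.
    by rewrite divr_ge0 ?normL2_ge0// ltW// calR0_gt0.
  move=> M M0 RM; have pt : 0 < t `^ (alpha - 1) by rewrite powR_gt0.
  (* With [tau' = t] the divisor cancels both $\mathcal{E}_1(t)=t^{\alpha-1}$ and the factor from
     [calR1_late]. *)
  have := @bound t t (M / t `^ (alpha - 1)) t0 tT (divr_ge0 M0 (ltW pt)).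
  rewrite /calE1 maxxx divfK ?gt_eqF// mul1r; apply => s st; have /andP[s0 _] := st.
  rewrite calR1_late// mulrA divfK ?gt_eqF//.
  by have := RM s st; rewrite ler_pdivrMr// calR0_gt0.
(* Enlarging $\mathcal{E}_1(t)$ to $t^{\alpha-1}$ requires a nonnegative supremum, which its member
   at $s=t$ provides. *)
- apply: (le_trans (bound1 _ _ tau0 tT)); apply: lee_wpmul2r.
    apply: (@le_trans _ _ (normL2 Omega (Rh t) / calR1 alpha lambda tau t)%:E).
      by rewrite lee_fin divr_ge0 ?normL2_ge0// ltW// calR1_gt0.
    by apply: ereal_sup_ubound; exists t => //=; rewrite in_itv/= t0 lexx.
  by rewrite lee_fin le0_ger_powR// ?le_max ?lexx ?orbT//; lra.
Qed.
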